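(* Let $\mathcal{X}$ be a two-sided quaternionic Banach space, let $U_+\subset\mathbb{H}$ be a bounded axially symmetric open set, let $U_-=\mathbb{H}\setminus\overline{U_+}$, and let $\Gamma:=\partial U_+$ be the piecewise $\mathcal{C}^1$-contour of $U_+$. Consider any $j\in\mathbb{S}$ and $f\in\mathcal{C}^\alpha(\Gamma_j,\mathcal{X})$ for $\alpha\in(0,1)$, where $\Gamma_j=\Gamma\cap\mathbb{C}_j$. Let $$\hat f(p)=\frac{1}{2\pi}\int_{\partial(U_+\cap\mathbb{C}_j)}S_L^{-1}(s,p)\,ds_j\,f(s),\qquad p\in\mathbb{H}\setminus\partial U_+,$$ be the left Cauchy integral transform of $f$, and set $$\hat f_+:=\hat f\big|_{U_+},\qquad \hat f_-:=-\hat f\big|_{U_-}.$$ Then the two following conditions are equivalent: (i) The function $\hat f_+$ admits a Hölder continuous extension of order $\alpha$ to $\overline{U_+}$, and the function $\hat f_-$ admits a Hölder continuous extension of order $\alpha$ to $\overline{U_-}\cup\{\infty\}$. (ii) If we denote these extensions by $f_+$ and $f_-$, then we have $f=f_++f_-$ on $\Gamma_j$.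
   Context: $\mathbb{H}$ is the algebra of quaternions; $\mathbb{S}$ is the 2-sphere of purely imaginary unit quaternions; $\mathbb{C}_j=\mathbb{R}+j\mathbb{R}$ for $j\in\mathbb{S}$. For $q=x_0+j|\mathrm{Im}(q)|$, $[q]=\{x_0+i|\mathrm{Im}(q)|: i\in\mathbb{S}\}$; a set is axially symmetric if it contains $[q]$ whenever it contains $q$. A left slice function is a function of the form $f(u+jv)=f_0(u,v)+jf_1(u,v)$, where the $\mathcal{X}$-valued functions $f_0,f_1$ depend only on $(u,v)$ and satisfy $f_0(u,-v)=f_0(u,v)$, $f_1(u,-v)=-f_1(u,v)$. It is Hölder slice continuous of order $\alpha\in(0,1)$ if $f_0$ and $f_1$ are Hölder continuous of order $\alpha$ on the corresponding set of pairs $(u,v)\in\mathbb{R}^2$. $\mathcal{C}^\alpha(\Gamma_j,\mathcal{X})$ denotes the space of such functions on $\Gamma_j$. Regularity of a function $g$ at $\infty$ is understood as regularity of $p\mapsto g(1/p)$ at $p=0$. Cauchy kernel: $S_L^{-1}(s,p)=-(p^2-2p\,\mathrm{Re}(s)+|s|^2)^{-1}(p-\overline{s})$; $ds_j=ds/j=-j\,ds$. That $\Gamma$ is the piecewise $\mathcal{C}^1$-contour of $U_+$ means that, for every $j\in\mathbb{S}$, $\Gamma_j=\partial(U_+\cap\mathbb{C}_j)$ is a piecewise $\mathcal{C}^1$-contour in $\mathbb{C}_j$, i.e. a finite union of pairwise disjoint connected simple curves, each having a continuous, piecewise $\mathcal{C}^1$ parametrization with nonvanishing (one-sided) derivatives,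 such that at each corner the quotient of the two one-sided derivatives lies in $\mathbb{C}_j\setminus(-\infty,0]$; here it is closed and oriented as the boundary of $U_+\cap\mathbb{C}_j$. *)

(* Defs.v *)
From Stdlib Require Import Reals Lra List.
From Coquelicot Require Import Coquelicot.

Set Implicit Arguments.
Open Scope R_scope.

(* [(a, b, c, d)] is a + b e1 + c e2 + d e3.  The product structures of
   Coquelicot provide the real vector space structure, the topology and the
   Euclidean norm (see [norm_quat]). *)
Definition quat : Type := (R * R * R * R)%type.

Lemma norm_quat (a b c d : R) :
  norm ((a, b, c, d) : quat) = sqrt (a ^ 2 + b ^ 2 + c ^ 2 + d ^ 2).
Proof.
change (sqrt (sqrt (sqrt (Rabs a ^ 2 + Rabs b ^ 2) ^ 2 + Rabs c ^ 2) ^ 2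
              + Rabs d ^ 2) = sqrt (a ^ 2 + b ^ 2 + c ^ 2 + d ^ 2)).
assert (Ha := pow2_ge_0 a); assert (Hb := pow2_ge_0 b);
  assert (Hc := pow2_ge_0 c).
now rewrite !pow2_abs, !pow2_sqrt by (try rewrite pow2_sqrt; lra).
Qed.

Definition qreal (r : R) : quat := (r, 0, 0, 0).
Definition qRe (q : quat) : R := let '(a, _, _, _) := q in a.
Definition qIm (q : quat) : quat := let '(_, b, c, d) := q in (0, b, c, d).
Definition qconj (q : quat) : quat :=
  let '(a, b, c, d) := q in (a, - b, - c, - d).

Definition qmul (p q : quat) : quat :=
  let '(a1, b1, c1, d1) := p in
  let '(a2, b2, c2, d2) := q in
  (a1 * a2 - b1 * b2 - c1 * c2 - d1 * d2,
   a1 * b2 + b1 * a2 + c1 * d2 - d1 * c2,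
   a1 * c2 - b1 * d2 + c1 * a2 + d1 * b2,
   a1 * d2 + b1 * c2 - c1 * b2 + d1 * a2).

(* [qinv zero] is a junk value: it is [zero], since [qconj zero] is. *)
Definition qinv (q : quat) : quat := scal (/ norm q ^ 2) (qconj q).

Definition imag_unit (j : quat) : Prop := qRe j = 0 /\ norm j = 1.

(* The point u + j v of the plane C_j, for (u, v) read as u + i v in C. *)
Definition slice_pt (j : quat) (z : C) : quat :=
  plus (qreal (fst z)) (scal (snd z) j).

Definition qsphere (q p : quat) : Prop :=
  exists i, imag_unit i /\ p = slice_pt i (qRe q, norm (qIm q)).

Definition axially_symmetric (U : quat -> Prop) : Prop :=
  forall q p, U q -> qsphere q p -> U p.

Definition qbounded (U : quat -> Prop) : Prop :=
  exists M : R, forall q, U q -> norm q <= M.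

Definition closure {T : UniformSpace} (A : T -> Prop) (x : T) : Prop :=
  forall eps : posreal, exists y, ball x eps y /\ A y.

Definition boundary {T : UniformSpace} (A : T -> Prop) (x : T) : Prop :=
  closure A x /\ closure (fun y => ~ A y) x.

Definition exterior (U : quat -> Prop) (q : quat) : Prop := ~ closure U q.

(* The set {(u, v) | u + j v in A}, that is, A intersected with C_j. *)
Definition slice (j : quat) (A : quat -> Prop) (z : C) : Prop :=
  A (slice_pt j z).

Record qbanach := QBanach {
  qbanach_car :> CompleteNormedModule R_AbsRing;
  lact : quat -> qbanach_car -> qbanach_car;
  ract : qbanach_car -> quat -> qbanach_car;
  lact_plus_l : forall p q x, lact (plus p q) x = plus (lact p x) (lact q x);
  lact_plus_r : forall q x y, lact q (plus x y) = plus (lact q x) (lact q y);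
  lact_mul : forall p q x, lact (qmul p q) x = lact p (lact q x);
  ract_plus_l : forall q x y, ract (plus x y) q = plus (ract x q) (ract y q);
  ract_plus_r : forall p q x, ract x (plus p q) = plus (ract x p) (ract x q);
  ract_mul : forall p q x, ract x (qmul p q) = ract (ract x p) q;
  lact_ract : forall p q x, ract (lact p x) q = lact p (ract x q);
  lact_real : forall (r : R) x, lact (qreal r) x = scal r x;
  ract_real : forall (r : R) x, ract x (qreal r) = scal r x;
  norm_lact : forall q x, norm (lact q x) = norm q * norm x;
  norm_ract : forall q x, norm (ract x q) = norm q * norm x
}.

Arguments lact {_} _ _.
Arguments ract {_} _ _.

Definition holder_on {V W : NormedModule R_AbsRing} (alpha : R)
    (D : V -> Prop) (g : V -> W) : Prop :=
  exists M : R, forall x y, D x -> D y -> x <> y ->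
    norm (minus (g x) (g y)) <= M * Rpower (norm (minus x y)) alpha.

(* The one-point compactification of the quaternions is [option quat], with
   [None] as the point at infinity. *)
Definition inv_infty (p : quat) : option quat :=
  if Req_EM_T (norm p) 0 then None else Some (qinv p).

(* Hölder continuity on D together with the point at infinity, when D contains
   a neighbourhood of infinity: at infinity this means that p |-> g (1/p) is
   Hölder continuous near p = 0. *)
Definition holder_on_infty (X : qbanach) (alpha : R) (D : quat -> Prop)
    (g : option quat -> X) : Prop :=
  holder_on alpha D (fun p => g (Some p)) /\
  exists r : R, 0 < r /\
    (forall p : quat, 0 < norm p < r -> D (qinv p)) /\
    holder_on alpha (fun p : quat => norm p < r) (fun p => g (inv_infty p)).

(* [f] is only considered on the part of the slice C_j lying in A. *)
Definition slice_holder (X : qbanach) (alpha : R) (j : quat)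
    (A : quat -> Prop) (f : quat -> X) : Prop :=
  exists f0 f1 : R * R -> X,
    (forall u v, slice j A (u, v) ->
       f0 (u, - v) = f0 (u, v) /\
       f1 (u, - v) = opp (f1 (u, v)) /\
       f (slice_pt j (u, v)) = plus (f0 (u, v)) (lact j (f1 (u, v)))) /\
    holder_on alpha (slice j A) f0 /\
    holder_on alpha (slice j A) f1.

(* The plane C_j is identified with C by [slice_pt j].  A parametrized curve
   is [path] on [knot 0, knot (nsub + 1)]; its smooth arcs are the closed
   intervals [knot k, knot (k + 1)] for k <= nsub, and [vel k] is the
   derivative along the k-th arc, one-sided at both ends. *)
Record pcurve := PCurve {
  nsub : nat;
  knot : nat -> R;
  path : R -> C;
  vel : nat -> R -> C
}.

Definition on_curve (c : pcurve) (z : C) : Prop :=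
  exists t, knot c 0 <= t <= knot c (S (nsub c)) /\ path c t = z.

(* The derivative of g at t with respect to the set I. *)
Definition derive_within (I : R -> Prop) (g : R -> C) (t : R) (l : C) : Prop :=
  filterlim (fun s => ((g s - g t) / RtoC (s - t))%C)
    (within I (locally' t)) (locally l).

Definition no_cusp (l r : C) : Prop :=
  ~ exists x : R, x <= 0 /\ (r / l)%C = RtoC x.

(* Continuity of [path] follows from differentiability along the closed arcs. *)
Definition closed_pw_C1 (c : pcurve) : Prop :=
  (forall k, (k <= nsub c)%nat ->
     knot c k < knot c (S k) /\
     forall t, knot c k <= t <= knot c (S k) ->
       let arc := fun s => knot c k <= s <= knot c (S k) in
       derive_within arc (path c) t (vel c k t) /\
       filterlim (vel c k) (within arc (locally t)) (locally (vel c k t)) /\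
       vel c k t <> RtoC 0) /\
  path c (knot c (S (nsub c))) = path c (knot c 0) /\
  (forall k, (k < nsub c)%nat ->
     no_cusp (vel c k (knot c (S k))) (vel c (S k) (knot c (S k)))) /\
  no_cusp (vel c (nsub c) (knot c (S (nsub c)))) (vel c 0%nat (knot c 0)).

Definition simple_closed (c : pcurve) : Prop :=
  forall s t,
    knot c 0 <= s < knot c (S (nsub c)) ->
    knot c 0 <= t < knot c (S (nsub c)) ->
    path c s = path c t -> s = t.

(* At every smooth point, D lies to the left of the curve and the complement
   of its closure to the right. *)
Definition oriented_by (D : C -> Prop) (c : pcurve) : Prop :=
  forall k t, (k <= nsub c)%nat -> knot c k < t < knot c (S k) ->
    exists delta : R, 0 < delta /\ forall eps : R, 0 < eps < delta ->
      D (path c t + RtoC eps * (Ci * vel c k t))%C /\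
      ~ closure D (path c t - RtoC eps * (Ci * vel c k t))%C.

Definition oriented_boundary (D : C -> Prop) (cs : list pcurve) : Prop :=
  (forall c, In c cs ->
     closed_pw_C1 c /\ simple_closed c /\ oriented_by D c) /\
  ForallOrdPairs (fun c1 c2 => forall z, ~ (on_curve c1 z /\ on_curve c2 z))
    cs /\
  (forall z, boundary D z <-> exists c, In c cs /\ on_curve c z).

(* -(p^2 - 2 p Re(s) + |s|^2)^{-1} (p - conj s) *)
Definition SLinv (s p : quat) : quat :=
  opp (qmul
    (qinv (plus (minus (qmul p p) (scal (2 * qRe s) p)) (qreal (norm s ^ 2))))
    (minus p (qconj s))).

(* The integral of S_L^{-1}(s, p) ds_j f(s) over the curve s = path t in C_j,
   where ds_j = - j ds. *)
Definition curve_integral (X : qbanach) (j : quat) (f : quat -> X) (p : quat)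
    (c : pcurve) : X :=
  sum_n (fun k =>
    RInt (fun t =>
      let s := slice_pt j (path c t) in
      let ds := slice_pt j (vel c k t) in
      lact (qmul (SLinv s p) (qmul (opp j) ds)) (f s))
      (knot c k) (knot c (S k))) (nsub c).

Definition cauchy_transform (X : qbanach) (j : quat) (cs : list pcurve)
    (f : quat -> X) (p : quat) : X :=
  scal (/ (2 * PI))
    (fold_right (fun c x => plus (curve_integral X j f p c) x) zero cs).

Definition holder_ext_plus (X : qbanach) (alpha : R) (U : quat -> Prop)
    (fhat : quat -> X) (fp : quat -> X) : Prop :=
  (forall p, U p -> fp p = fhat p) /\ holder_on alpha (closure U) fp.

Definition holder_ext_minus (X : qbanach) (alpha : R) (U : quat -> Prop)
    (fhat : quat -> X) (fm : option quat -> X) : Prop :=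
  (forall p, exterior U p -> fm (Some p) = opp (fhat p)) /\
  holder_on_infty X alpha (closure (exterior U)) fm.

(* Main.v *)
(* The converse direction is immediate; the other one is a Sokhotski-Plemelj jump
   formula.  On the slice C_j the kernel S_L^{-1}(s, p) is (s - p)^{-1}, since
   s and p commute.  At a smooth point z0 of the contour with velocity v0, put
   w+ = z0 + eps i v0, which lies in U_+, and w- = z0 - eps i v0, which lies in U_-.
   Then fhat(w+) - fhat(w-) is 1/(2 pi) times the integral of f against
   2 eps v0 ds / ((s - z0)^2 + (eps v0)^2), which in the parameter tau = t - t0 is
   close to the Poisson kernel 2 eps dtau / (tau^2 + eps^2), of total mass 2 pi.
   So the difference tends to f(z0), with no appeal to winding numbers, while it also
   tends to f_+(z0) + f_-(z0).  Smooth points are dense in the contour and all three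
   functions are continuous there. *)
Require Import Defs.
From Stdlib Require Import Reals List.
From Stdlib Require Import Arith Lra Lia.
From Coquelicot Require Import Coquelicot.
Open Scope R_scope.

(** * Quaternions on a slice *)

(** Taken alone, the kernels at w+ and w- have absolute integrals that grow like log(1/eps); only
    their difference is an approximate identity of bounded mass. The comparison with the Poisson
    kernel is therefore multiplicative: the error is a small multiple of the Poisson kernel itself,
    so that its integral is small uniformly in eps. Such a comparison holds only in a parameter
    window around t0, fixed before eps. Outside the window the contour stays away from z0, by
    simplicity and disjointness of the curves, and the difference kernel is O(eps). The formula
    defining S_L^{-1}(s, p) divides by a quadratic that vanishes at conj(p) as well as at p, so the
    conjugates of w+ and w- must also avoid the contour; axial symmetry provides this. The
    extensions live on closures taken in the quaternions, while the contour and its orientation are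
    given in C_j. Passing between the two closures is the second place where axial symmetry
    enters. *)

Lemma imag_unit_coord (j : quat) : imag_unit j ->
  exists b c d, j = (0, b, c, d) /\ b ^ 2 + c ^ 2 + d ^ 2 = 1.
Proof.
destruct j as [[[a b] c] d]; intros [Ha Hn]; simpl in Ha; subst a.
exists b, c, d; split; [reflexivity|].
rewrite norm_quat in Hn.
apply (f_equal (fun x => x ^ 2)) in Hn; rewrite pow2_sqrt in Hn; [lra|].
assert (Hb := pow2_ge_0 b); assert (Hc := pow2_ge_0 c);
  assert (Hd := pow2_ge_0 d); lra.
Qed.

Lemma slice_pt_coord (b c d x y : R) :
  slice_pt (0, b, c, d) (x, y) = (x, y * b, y * c, y * d).
Proof.
change ((x + y * 0, 0 + y * b, 0 + y * c, 0 + y * d) = (x, y * b, y * c, y * d)).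
now rewrite !Rplus_0_l, Rmult_0_r, Rplus_0_r.
Qed.

Lemma quat_eq (a b c d a' b' c' d' : R) :
  a = a' -> b = b' -> c = c' -> d = d' -> (a, b, c, d) = (a', b', c', d').
Proof. now intros; subst. Qed.

Lemma slice_pt_mul (j : quat) (z w : C) : imag_unit j ->
  qmul (slice_pt j z) (slice_pt j w) = slice_pt j (z * w)%C.
Proof.
intros Hj; destruct (imag_unit_coord _ Hj) as (b & c & d & -> & H).
destruct z as [x y], w as [x' y']; unfold Cmult; simpl fst; simpl snd.
rewrite !slice_pt_coord; apply quat_eq; try ring.
transitivity (x * x' - y * y' * (b ^ 2 + c ^ 2 + d ^ 2)); [ring|].
rewrite H; ring.
Qed.

Lemma slice_pt_quat (a b c d x y : R) :
  slice_pt (a, b, c, d) (x, y) = (x + y * a, 0 + y * b, 0 + y * c, 0 + y * d).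
Proof. reflexivity. Qed.

Lemma quat_plus (a b c d a' b' c' d' : R) :
  plus ((a, b, c, d) : quat) (a', b', c', d') = (a + a', b + b', c + c', d + d').
Proof. reflexivity. Qed.

Lemma quat_scal (r a b c d : R) :
  scal r ((a, b, c, d) : quat) = (r * a, r * b, r * c, r * d).
Proof. reflexivity. Qed.

Lemma quat_opp (a b c d : R) :
  opp ((a, b, c, d) : quat) = (- a, - b, - c, - d).
Proof. reflexivity. Qed.

Ltac quat_ring :=
  unfold Cmult, Cplus, Copp, RtoC, Ci, qreal; simpl fst; simpl snd;
  rewrite ?slice_pt_quat, ?quat_scal, ?quat_opp, ?quat_plus;
  apply quat_eq; ring.

Lemma slice_pt_plus (j : quat) (z w : C) :
  slice_pt j (z + w)%C = plus (slice_pt j z) (slice_pt j w).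
Proof.
destruct j as [[[a b] c] d], z as [x y], w as [x' y'].
quat_ring.
Qed.

Lemma slice_pt_scal (j : quat) (r : R) (z : C) :
  slice_pt j (RtoC r * z)%C = scal r (slice_pt j z).
Proof.
destruct j as [[[a b] c] d], z as [x y].
quat_ring.
Qed.

Lemma slice_pt_opp (j : quat) (z : C) :
  slice_pt j (- z)%C = opp (slice_pt j z).
Proof.
destruct j as [[[a b] c] d], z as [x y].
quat_ring.
Qed.

Lemma slice_pt_minus (j : quat) (z w : C) :
  slice_pt j (z - w)%C = minus (slice_pt j z) (slice_pt j w).
Proof. now unfold Cminus; rewrite slice_pt_plus, slice_pt_opp. Qed.

Lemma slice_pt_real (j : quat) (r : R) : slice_pt j (RtoC r) = qreal r.
Proof.
destruct j as [[[a b] c] d].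
quat_ring.
Qed.

Lemma slice_pt_Ci (j : quat) : slice_pt j Ci = j.
Proof.
destruct j as [[[a b] c] d].
quat_ring.
Qed.

Lemma norm_slice_pt (j : quat) (z : C) : imag_unit j ->
  norm (slice_pt j z) = Cmod z.
Proof.
intros Hj; destruct (imag_unit_coord _ Hj) as (b & c & d & -> & H).
destruct z as [x y]; rewrite slice_pt_coord, norm_quat; unfold Cmod; simpl fst; simpl snd.
f_equal; transitivity (x ^ 2 + y ^ 2 * (b ^ 2 + c ^ 2 + d ^ 2)); [ring|].
rewrite H; ring.
Qed.

Lemma slice_pt_conj (j : quat) (z : C) : imag_unit j ->
  qconj (slice_pt j z) = slice_pt j (Cconj z).
Proof.
intros Hj; destruct (imag_unit_coord _ Hj) as (b & c & d & -> & H).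
destruct z as [x y]; unfold Cconj; simpl fst; simpl snd; rewrite !slice_pt_coord.
simpl; apply quat_eq; ring.
Qed.

Lemma qRe_slice_pt (j : quat) (z : C) : imag_unit j ->
  qRe (slice_pt j z) = fst z.
Proof.
intros Hj; destruct (imag_unit_coord _ Hj) as (b & c & d & -> & H).
now destruct z as [x y]; rewrite slice_pt_coord.
Qed.

Lemma Cmod_sqr (z : C) : Cmod z ^ 2 = fst z ^ 2 + snd z ^ 2.
Proof.
unfold Cmod; apply pow2_sqrt.
assert (H := pow2_ge_0 (fst z)); assert (H' := pow2_ge_0 (snd z)); lra.
Qed.

Lemma slice_pt_inv (j : quat) (z : C) : imag_unit j ->
  qinv (slice_pt j z) = slice_pt j (/ z)%C.
Proof.
intros Hj; unfold qinv.
rewrite norm_slice_pt, slice_pt_conj, <- slice_pt_scal by assumption.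
f_equal; rewrite Cmod_sqr.
unfold Cinv, Cconj, Cmult, RtoC; simpl; f_equal; unfold Rdiv; ring.
Qed.

(** The quadratic factors as (w - z)(w - conj z), and its second factor cancels against p - conj(s).
    At z = conj w both vanish, and the convention [qinv zero = zero] would make the left side zero;
    hence the second exclusion. *)
Lemma SLinv_slice (j : quat) (z w : C) : imag_unit j ->
  z <> w -> z <> Cconj w ->
  SLinv (slice_pt j z) (slice_pt j w) = slice_pt j (/ (z - w))%C.
Proof.
intros Hj Hzw Hzw'; unfold SLinv.
rewrite norm_slice_pt, slice_pt_conj, qRe_slice_pt, slice_pt_mul by assumption.
rewrite <- slice_pt_scal, <- slice_pt_minus, <- (slice_pt_real j), <- slice_pt_plus.
rewrite slice_pt_inv, <- slice_pt_minus, slice_pt_mul, <- slice_pt_opp by assumption.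
f_equal.
replace (w * w - RtoC (2 * fst z) * w + RtoC (Cmod z ^ 2))%C
  with ((w - z) * (w - Cconj z))%C.
2: { rewrite Cmod_sqr; destruct z as [x y], w as [x' y'];
     unfold Cconj, Cmult, Cminus, Cplus, Copp, RtoC; simpl; f_equal; ring. }
field; repeat split.
- now intros H; apply Hzw; rewrite <- (Cplus_0_r w), <- H; ring.
- intros H; apply Hzw'; rewrite <- (Cconj_conj z); f_equal.
  now rewrite <- (Cplus_0_r (Cconj z)), <- H; ring.
- now intros H; apply Hzw; rewrite <- (Cplus_0_r z), <- H; ring.
Qed.

(** * The jump of a Cauchy integral along one arc *)

Lemma lact_scal_l (X : qbanach) (r : R) (p : quat) (x : X) :
  lact (scal r p) x = scal r (lact p x).
Proof.
rewrite <- lact_real, <- lact_mul; f_equal.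
destruct p as [[[a b] c] d]; rewrite quat_scal.
apply quat_eq; ring.
Qed.

Lemma lact_scal_r (X : qbanach) (r : R) (p : quat) (x : X) :
  lact p (scal r x) = scal r (lact p x).
Proof.
rewrite <- !lact_real, <- !lact_mul; f_equal.
destruct p as [[[a b] c] d].
apply quat_eq; ring.
Qed.

Lemma lact_linear (X : qbanach) (p : quat) :
  is_linear (fun x : X => lact p x).
Proof.
split.
- apply lact_plus_r.
- intros; apply lact_scal_r.
- exists (norm p + 1); split.
  + assert (H := norm_ge_0 p); lra.
  + intros x; rewrite norm_lact; apply Rmult_le_compat_r; [apply norm_ge_0|lra].
Qed.

Lemma lact_minus_l (X : qbanach) (p q : quat) (x : X) :
  lact (minus p q) x = minus (lact p x) (lact q x).
Proof.
unfold minus; rewrite lact_plus_l; f_equal.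
replace (opp q) with (scal (opp 1) q).
- rewrite lact_scal_l; apply (scal_opp_one (V := X)).
- destruct q as [[[a b] c] d]; rewrite quat_scal, quat_opp.
  apply quat_eq; change (opp 1) with (- (1)); ring.
Qed.

Lemma lact_slice (X : qbanach) (j : quat) (z : C) (x : X) :
  lact (slice_pt j z) x = plus (scal (fst z) x) (scal (snd z) (lact j x)).
Proof. now unfold slice_pt; rewrite lact_plus_l, lact_real, lact_scal_l. Qed.

(** * Continuity of the integrands *)

Lemma Cminus_neq_0 (z w : C) : z <> w -> (z - w)%C <> RtoC 0.
Proof. now intros H H0; apply H; rewrite <- (Cplus_0_r w), <- H0; ring. Qed.

(** Continuity is split into real coordinates to match [lact_slice], where a point of the slice acts
    through two real scalings. *)
Definition ccont (k : R -> C) (t : R) : Prop :=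
  continuous (fun s => fst (k s)) t /\ continuous (fun s => snd (k s)) t.

Lemma continuous_lact_slice (X : qbanach) (j : quat) (k : R -> C) (g : R -> X) t :
  ccont k t -> continuous g t ->
  continuous (fun s => lact (slice_pt j (k s)) (g s)) t.
Proof.
intros [H1 H2] Hg.
apply continuous_ext with
  (fun s => plus (scal (fst (k s)) (g s)) (scal (snd (k s)) (lact j (g s)))).
{ now intros s; rewrite lact_slice. }
apply (continuous_plus (V := X)); apply (continuous_scal (V := X)); auto.
apply continuous_comp with (2 := linear_cont _ _ (lact_linear X j)); assumption.
Qed.

Lemma ccont_const (z : C) t : ccont (fun _ => z) t.
Proof. split; apply continuous_const. Qed.

Lemma ccont_minus (k l : R -> C) t :
  ccont k t -> ccont l t -> ccont (fun s => k s - l s)%C t.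
Proof.
intros [H1 H2] [H3 H4]; split; simpl.
- apply (continuous_minus (V := R_NormedModule)); assumption.
- apply (continuous_minus (V := R_NormedModule)); assumption.
Qed.

Lemma ccont_plus (k l : R -> C) t :
  ccont k t -> ccont l t -> ccont (fun s => k s + l s)%C t.
Proof.
intros [H1 H2] [H3 H4]; split; simpl.
- apply (continuous_plus (V := R_NormedModule)); assumption.
- apply (continuous_plus (V := R_NormedModule)); assumption.
Qed.

Lemma ccont_mult (k l : R -> C) t :
  ccont k t -> ccont l t -> ccont (fun s => k s * l s)%C t.
Proof.
intros [H1 H2] [H3 H4]; split; simpl.
- apply (continuous_minus (V := R_NormedModule));
    apply (continuous_mult (K := R_AbsRing)); assumption.
- apply (continuous_plus (V := R_NormedModule));
    apply (continuous_mult (K := R_AbsRing)); assumption.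
Qed.

Lemma Cmod2_neq_0 (z : C) : z <> RtoC 0 -> fst z ^ 2 + snd z ^ 2 <> 0.
Proof.
intros H; rewrite <- Cmod_sqr; apply pow_nonzero.
apply Rgt_not_eq, Cmod_gt_0, H.
Qed.

Lemma ccont_inv (k : R -> C) t :
  ccont k t -> k t <> RtoC 0 -> ccont (fun s => / k s)%C t.
Proof.
intros [H1 H2] H0.
assert (Hd : continuous (fun s => / (fst (k s) ^ 2 + snd (k s) ^ 2)) t).
{ apply continuous_comp with (g := Rinv).
  - apply continuous_ext with
      (fun s => fst (k s) * fst (k s) + snd (k s) * snd (k s)).
    { intros s; simpl; ring. }
    apply (continuous_plus (V := R_NormedModule));
      apply (continuous_mult (K := R_AbsRing)); assumption.
  - apply continuous_Rinv, Cmod2_neq_0, H0. }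
split; simpl; unfold Rdiv; apply (continuous_mult (K := R_AbsRing)); auto.
now apply (continuous_opp (V := R_NormedModule)).
Qed.

Lemma ccont_bounded (k : R -> C) a b :
  (forall t, a <= t <= b -> ccont k t) ->
  exists M, 0 < M /\ forall t, a <= t <= b -> Cmod (k t) <= M.
Proof.
intros H.
destruct (bounded_continuity (V := R_NormedModule) (fun t => fst (k t)) a b)
  as [M1 HM1]; [intros t Ht; apply (H t Ht)|].
destruct (bounded_continuity (V := R_NormedModule) (fun t => snd (k t)) a b)
  as [M2 HM2]; [intros t Ht; apply (H t Ht)|].
exists (Rabs M1 + Rabs M2 + 1); split.
{ assert (H1 := Rabs_pos M1); assert (H2 := Rabs_pos M2); lra. }
intros t Ht.
specialize (HM1 t Ht); specialize (HM2 t Ht).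
assert (HC : Cmod (k t) <= Rabs (fst (k t)) + Rabs (snd (k t))).
{ destruct (k t) as [x y]; simpl fst; simpl snd.
  replace (x, y) with (RtoC x + RtoC y * Ci)%C.
  - eapply Rle_trans; [apply Cmod_triangle|].
    rewrite Cmod_mult, !Cmod_R; replace (Cmod Ci) with 1; [lra|].
    unfold Cmod, Ci; simpl; rewrite <- sqrt_1 at 1; f_equal; ring.
  - unfold Cplus, Cmult, RtoC, Ci; simpl; f_equal; ring. }
change (Rabs (fst (k t)) < M1) in HM1; change (Rabs (snd (k t)) < M2) in HM2.
assert (H1 := Rle_abs M1); assert (H2 := Rle_abs M2); lra.
Qed.

Lemma norm_minus_zero (V : CompleteNormedModule R_AbsRing) (x : V) :
  norm (minus x zero) = norm x.
Proof. now rewrite minus_zero_r. Qed.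

Lemma locally_norm_lt (V : NormedModule R_AbsRing) (x : V) (e : R) :
  0 < e -> locally x (fun y => norm (minus y x) < e).
Proof.
intros He; apply (locally_le_locally_norm x (fun y => norm (minus y x) < e)).
now exists (mkposreal e He).
Qed.

Lemma filterlim_at_right_0 (V : NormedModule R_AbsRing) (I : R -> V) (l : V) :
  filterlim I (at_right 0) (locally l) <->
  (forall e, 0 < e -> exists d, 0 < d /\
     forall eps, 0 < eps < d -> norm (minus (I eps) l) < e).
Proof.
split.
- intros H e He.
  destruct (H _ (locally_norm_lt V l e He)) as [d Hd].
  exists d; split; [apply cond_pos|].
  intros eps Heps; apply Hd; [|lra].
  change (Rabs (eps - 0) < d); rewrite Rminus_0_r, Rabs_pos_eq; lra.
- intros H; apply filterlim_locally; intros e.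
  destruct (H e (cond_pos e)) as (d & Hd & HI).
  exists (mkposreal d Hd); intros eps Hball Heps.
  apply norm_compat1, HI; split; [assumption|].
  change (Rabs (eps - 0) < d) in Hball.
  rewrite Rminus_0_r in Hball; apply Rle_lt_trans with (2 := Hball), Rle_abs.
Qed.

(* With w+ = z0 + eps i v0 and w- = z0 - eps i v0, this is
   - i ds ((s - w+)^-1 - (s - w-)^-1). *)
Definition jump_kernel (z0 v0 : C) (eps : R) (s ds : C) : C :=
  (RtoC (2 * eps) * v0 * ds / ((s - z0) * (s - z0) + RtoC eps * v0 * (RtoC eps * v0)))%C.

Lemma jump_kernel_cont (z0 v0 : C) eps (z v : R -> C) t :
  ccont z t -> ccont v t ->
  ((z t - z0) * (z t - z0) + RtoC eps * v0 * (RtoC eps * v0))%C <> RtoC 0 ->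
  ccont (fun s => jump_kernel z0 v0 eps (z s) (v s)) t.
Proof.
intros Hz Hv H0; unfold jump_kernel, Cdiv.
apply ccont_mult; [apply ccont_mult; [apply ccont_const|assumption]|].
apply ccont_inv; [|assumption].
apply ccont_plus; [|apply ccont_const].
now apply ccont_mult; apply ccont_minus; try apply ccont_const.
Qed.

(** By compactness |z t - z0| is bounded below on [a, b], so the kernel is O(eps) uniformly in t.
    The nonvanishing of the denominator for each small eps gives continuity, hence integrability, of
    the integrand. *)
Lemma jump_kernel_integral_far (X : qbanach) (j : quat) (hj : imag_unit j)
    (z v : R -> C) (g : R -> X) (z0 v0 : C) (a b d0 : R) :
  a <= b -> (forall t, ccont z t) -> (forall t, ccont v t) ->
  (forall t, continuous g t) ->
  (forall t, a <= t <= b -> z t <> z0) ->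
  0 < d0 ->
  (forall eps t, 0 < eps < d0 ->
     ((z t - z0) * (z t - z0) + RtoC eps * v0 * (RtoC eps * v0))%C <> RtoC 0) ->
  filterlim (fun eps =>
      RInt (fun t => lact (slice_pt j (jump_kernel z0 v0 eps (z t) (v t))) (g t)) a b)
    (at_right 0) (locally (zero : X)).
Proof.
intros Hab Hz Hv Hg Hne Hd0 Hnz.
destruct (ccont_bounded (fun t => / ((z t - z0) * (z t - z0)))%C a b)
  as (M & HM0 & HM).
{ intros t Ht; apply ccont_inv.
  - now apply ccont_mult; apply ccont_minus; try apply ccont_const.
  - now apply Cmult_neq_0; apply Cminus_neq_0, Hne. }
destruct (ccont_bounded v a b (fun t _ => Hv t)) as (V & HV0 & HV).
destruct (bounded_continuity (V := X) g a b) as [G' HG']; [intros; apply Hg|].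
set (G := Rabs G' + 1).
assert (HG0 : 0 < G) by (unfold G; assert (H := Rabs_pos G'); lra).
assert (HG : forall t, a <= t <= b -> norm (g t) <= G).
{ intros t Ht; specialize (HG' t Ht); unfold G; assert (H := Rle_abs G'); lra. }
set (W := Cmod v0 + 1).
assert (HW : Cmod v0 <= W /\ 1 <= W).
{ unfold W; assert (H := Cmod_ge_0 v0); lra. }
clearbody G W.
(* Here |z t - z0|^2 is at least 1/M. As eps < 1, the term (eps v0)^2 is at most eps W^2, which the
   second condition makes smaller than 1/(2M); so the denominator is at least 1/(2M) in modulus. *)
assert (HK : forall eps t, 0 < eps < 1 -> eps * (W * W) * (2 * M) < 1 -> a <= t <= b ->
  Cmod (jump_kernel z0 v0 eps (z t) (v t)) <= eps * (2 * W * V * (2 * M))).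
{ intros eps t He HeM Ht.
  specialize (HM t Ht); specialize (HV t Ht); specialize (Hne t Ht).
  assert (Hzz : (z t - z0)%C <> RtoC 0) by now apply Cminus_neq_0.
  assert (Hzz2 : ((z t - z0) * (z t - z0))%C <> RtoC 0) by now apply Cmult_neq_0.
  rewrite Cmod_inv in HM by assumption.
  assert (Hr : 0 < Cmod ((z t - z0) * (z t - z0))) by now apply Cmod_gt_0.
  set (r := Cmod ((z t - z0) * (z t - z0))) in *.
  assert (HrM : 1 <= M * r).
  { apply Rmult_le_compat_r with (r := r) in HM; [|lra].
    now rewrite Rinv_l in HM by lra. }
  set (den := ((z t - z0) * (z t - z0) + RtoC eps * v0 * (RtoC eps * v0))%C).
  assert (Hq : Cmod (RtoC eps * v0 * (RtoC eps * v0)) <= eps * (W * W)).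
  { rewrite !Cmod_mult, Cmod_R, Rabs_pos_eq by lra.
    assert (Cmod v0 * Cmod v0 <= W * W)
      by (apply Rmult_le_compat; try apply Cmod_ge_0; lra).
    apply Rle_trans with (eps * (eps * (Cmod v0 * Cmod v0))); [lra|].
    apply Rmult_le_compat_l; [lra|].
    assert (0 <= Cmod v0 * Cmod v0) by (apply Rmult_le_pos; apply Cmod_ge_0).
    nra. }
  assert (Hden : r <= Cmod den + eps * (W * W)).
  { apply Rle_trans with (2 := Rplus_le_compat_l _ _ _ Hq).
    rewrite <- (Cmod_opp (_ * _ * _)).
    apply Rle_trans with (2 := Cmod_triangle _ _).
    unfold r, den; apply Req_le; f_equal; ring. }
  assert (Hden2 : 1 <= 2 * M * Cmod den) by nra.
  assert (Hden0 : 0 < Cmod den).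
  { destruct (Cmod_ge_0 den) as [h|h]; [assumption|rewrite <- h in Hden2; lra]. }
  unfold jump_kernel; fold den.
  rewrite Cmod_div by now apply Cmod_gt_0.
  rewrite !Cmod_mult, Cmod_R, Rabs_pos_eq by lra.
  apply Rle_div_l; [assumption|].
  assert (0 <= Cmod v0) by apply Cmod_ge_0; assert (0 <= Cmod (v t)) by apply Cmod_ge_0.
  assert (Cmod v0 * Cmod (v t) <= W * V) by (apply Rmult_le_compat; lra).
  assert (0 <= Cmod v0 * Cmod (v t)) by now apply Rmult_le_pos.
  assert (0 < W * V) by (apply Rmult_lt_0_compat; lra).
  apply Rle_trans with (2 * eps * (W * V) * 1); [nra|].
  apply Rle_trans with (2 * eps * (W * V) * (2 * M * Cmod den)); [|lra].
  apply Rmult_le_compat_l; [nra|assumption]. }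
apply (filterlim_at_right_0 X); intros e He.
(* The added 1 keeps B positive when a = b, as B is divided by below. *)
set (B := 2 * W * V * (2 * M) * G * (b - a + 1)).
assert (HB : 0 < B) by (unfold B; repeat apply Rmult_lt_0_compat; lra).
assert (HWM : 0 < W * W * (2 * M)) by (repeat apply Rmult_lt_0_compat; lra).
exists (Rmin (Rmin d0 1) (Rmin (/ (W * W * (2 * M))) (e / B))); split.
{ repeat apply Rmin_pos; try lra.
  - now apply Rinv_0_lt_compat.
  - now apply Rdiv_lt_0_compat. }
intros eps [He0 He1].
assert (He2 : eps < d0 /\ eps < 1 /\ eps < / (W * W * (2 * M)) /\ eps < e / B).
{ repeat split; apply Rlt_le_trans with (1 := He1).
  - eapply Rle_trans; [apply Rmin_l|apply Rmin_l].
  - eapply Rle_trans; [apply Rmin_l|apply Rmin_r].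
  - eapply Rle_trans; [apply Rmin_r|apply Rmin_l].
  - eapply Rle_trans; [apply Rmin_r|apply Rmin_r]. }
clear He1; destruct He2 as (He1 & He2 & He3 & He4).
rewrite (norm_minus_zero X).
apply Rle_lt_trans with (eps * (2 * W * V * (2 * M)) * G * (b - a)).
- replace (eps * (2 * W * V * (2 * M)) * G * (b - a))
    with (scal (b - a) (eps * (2 * W * V * (2 * M)) * G))
    by (change scal with Rmult; simpl; ring).
  eapply (norm_RInt_le (V := X)) with (3 := RInt_correct _ _ _ _) (4 := is_RInt_const _ _ _);
    [assumption|].
  intros t Ht; simpl; rewrite norm_lact, norm_slice_pt by assumption.
  apply Rmult_le_compat; try apply Cmod_ge_0; try apply norm_ge_0; auto.
  apply HK; auto; try lra.
  apply Rmult_lt_compat_r with (r := W * W * (2 * M)) in He3; [|assumption].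
  rewrite Rinv_l in He3; lra.
- apply Rlt_div_r in He4; [|assumption].
  apply Rle_lt_trans with (2 := He4); unfold B.
  assert (0 < eps * (2 * W * V * (2 * M)) * G) by (repeat apply Rmult_lt_0_compat; lra).
  nra.
Unshelve.
apply ex_RInt_continuous; intros t _; apply continuous_lact_slice; auto.
apply jump_kernel_cont; auto.
Qed.
(** After division by v0 the kernel is 2 eps w / D, with w near 1 and D near P = tau^2 + eps^2. The
    bound is relative to the Poisson kernel because the mass of the latter never exceeds 2 pi,
    whatever eps. The constant is 4 * 4: the numerator wP - D is at most 4 eta P, of which 3 eta P
    comes from D, and eta <= 1/4 gives |D| >= P/4. *)
Lemma jump_kernel_near (z0 v0 s ds : C) (eps tau eta : R) :
  v0 <> RtoC 0 -> 0 < eps -> 0 <= eta <= 1 / 4 ->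
  Cmod (s - z0 - RtoC tau * v0) <= eta * Cmod v0 * Rabs tau ->
  Cmod (ds - v0) <= eta * Cmod v0 ->
  Cmod (jump_kernel z0 v0 eps s ds - RtoC (2 * eps / (tau ^ 2 + eps ^ 2)))
    <= 16 * eta * (2 * eps / (tau ^ 2 + eps ^ 2)).
Proof.
intros Hv0 He Heta Hs Hds.
assert (Hm : 0 < Cmod v0) by now apply Cmod_gt_0.
set (zeta := ((s - z0) / v0)%C).
set (w := (ds / v0)%C).
set (P := tau ^ 2 + eps ^ 2).
assert (HP : 0 < P) by (unfold P; nra).
assert (Hz : Cmod (zeta - RtoC tau) <= eta * Rabs tau).
{ replace (zeta - RtoC tau)%C with ((s - z0 - RtoC tau * v0) / v0)%C
    by (unfold zeta; field; assumption).
  rewrite Cmod_div by assumption.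
  apply Rle_div_l; [assumption|]; lra. }
assert (Hw : Cmod (w - 1) <= eta).
{ replace (w - 1)%C with ((ds - v0) / v0)%C by (unfold w; field; assumption).
  rewrite Cmod_div by assumption; now apply Rle_div_l. }
assert (Hz2 : Cmod (zeta * zeta - RtoC (tau ^ 2)) <= 3 * eta * tau ^ 2).
{ replace (zeta * zeta - RtoC (tau ^ 2))%C
    with ((zeta - RtoC tau) * ((zeta - RtoC tau) + RtoC (2 * tau)))%C.
  2: { rewrite RtoC_mult; simpl pow; rewrite !RtoC_mult; ring. }
  rewrite Cmod_mult.
  assert (H : Cmod (zeta - RtoC tau + RtoC (2 * tau)) <= 3 * Rabs tau).
  { eapply Rle_trans; [apply Cmod_triangle|].
    rewrite Cmod_R, Rabs_mult, (Rabs_pos_eq 2) by lra.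
    assert (H0 := Rabs_pos tau); nra. }
  assert (H0 := Rabs_pos tau).
  rewrite <- (pow2_abs tau).
  apply Rle_trans with ((eta * Rabs tau) * (3 * Rabs tau)); [|lra].
  apply Rmult_le_compat; try apply Cmod_ge_0; assumption. }
set (D := (zeta * zeta + RtoC (eps ^ 2))%C).
assert (HDP : Cmod (D - RtoC P) <= 3 * eta * P).
{ replace (D - RtoC P)%C with (zeta * zeta - RtoC (tau ^ 2))%C.
  - eapply Rle_trans; [exact Hz2|]. unfold P; nra.
  - unfold D, P; rewrite RtoC_plus; ring. }
assert (HD : P / 4 <= Cmod D).
{ assert (H : P <= Cmod D + Cmod (D - RtoC P)).
  { rewrite <- (Rabs_pos_eq P) at 1 by lra; rewrite <- Cmod_R.
    rewrite <- (Cmod_opp (D - RtoC P)).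
    eapply Rle_trans; [|apply Cmod_triangle].
    apply Req_le; f_equal; ring. }
  nra. }
assert (HD0 : D <> RtoC 0) by (apply Cmod_gt_0; lra).
assert (HP0 : RtoC P <> RtoC 0) by (apply Cmod_gt_0; rewrite Cmod_R, Rabs_pos_eq; lra).
assert (Hnum : Cmod (w * RtoC P - D) <= 4 * eta * P).
{ replace (w * RtoC P - D)%C with ((w - 1) * RtoC P + - (D - RtoC P))%C by ring.
  eapply Rle_trans; [apply Cmod_triangle|].
  rewrite Cmod_opp, Cmod_mult, Cmod_R, Rabs_pos_eq by lra; nra. }
replace (jump_kernel z0 v0 eps s ds - RtoC (2 * eps / P))%C
  with (RtoC (2 * eps) * (w * RtoC P - D) / (D * RtoC P))%C.
- rewrite Cmod_div by now apply Cmult_neq_0.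
  rewrite !Cmod_mult, !Cmod_R, !Rabs_pos_eq by lra.
  apply Rle_div_l; [apply Rmult_lt_0_compat; lra|].
  replace (16 * eta * (2 * eps / P) * (Cmod D * P))
    with (2 * eps * (16 * eta * Cmod D)) by (field; lra).
  apply Rmult_le_compat_l; [lra|]; nra.
- unfold jump_kernel.
  replace ((s - z0) * (s - z0) + RtoC eps * v0 * (RtoC eps * v0))%C
    with (v0 * v0 * D)%C.
  + rewrite RtoC_div by lra; unfold w; field; repeat split; assumption.
  + unfold D, zeta; replace (eps ^ 2) with (eps * eps) by ring.
    rewrite RtoC_mult; field; assumption.
Qed.

(** A primitive of the kernel is 2 atan((t - t0)/eps). Values in [V] let the same statement serve
    for the main term in X and, with V the real line, for the majorant of the error. *)
Lemma poisson_integral (V : CompleteNormedModule R_AbsRing) (x : V) (t0 d eps : R) :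
  0 < eps ->
  is_RInt (fun t => scal (2 * eps / ((t - t0) ^ 2 + eps ^ 2)) x) (t0 - d) (t0 + d)
    (scal (4 * atan (d / eps)) x).
Proof.
intros He.
assert (Hpos : forall t, 0 < (t - t0) ^ 2 + eps ^ 2) 
  by (intros t; assert (H := pow2_ge_0 (t - t0)); assert (H' := pow_lt eps 2 He); lra).
replace (scal (4 * atan (d / eps)) x)
  with (minus (scal (2 * atan ((t0 + d - t0) / eps)) x)
              (scal (2 * atan ((t0 - d - t0) / eps)) x)).
- apply (is_RInt_derive (fun t => scal (2 * atan ((t - t0) / eps)) x)).
  + intros t _; specialize (Hpos t).
    apply (is_derive_scal_l (V := V) (fun t => 2 * atan ((t - t0) / eps)) t
      (2 * eps / ((t - t0) ^ 2 + eps ^ 2)) x).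
    evar_last.
    { apply is_derive_scal, (is_derive_comp atan (fun t => (t - t0) / eps)).
      - apply is_derive_atan.
      - auto_derive; [trivial|reflexivity]. }
    unfold scal; simpl; unfold mult; simpl; unfold Rsqr; field.
    split; [nra|]; lra.
  + intros t _; specialize (Hpos t).
    apply (continuous_scal_l (V := V)).
    apply (ex_derive_continuous (V := R_NormedModule)); auto_derive; lra.
- replace ((t0 + d - t0) / eps) with (d / eps) by (field; lra).
  replace ((t0 - d - t0) / eps) with (- (d / eps)) by (field; lra).
  rewrite atan_opp, <- (scal_minus_distr_r (V := V)); f_equal.
  unfold minus, plus, opp; simpl; ring.
Qed.

(** This follows from atan x + atan(1/x) = pi/2 and atan y <= y for y > 0. With x = d/eps it says
    that the Poisson mass outside the window of radius d is at most 4 eps/d. *)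
Lemma atan_near_PI2 (x : R) : 0 < x -> PI / 2 - / x <= atan x <= PI / 2.
Proof.
intros Hx; split; [|assert (H := atan_bound x); lra].
assert (H := atan_inv x Hx).
assert (H' : atan (/ x) <= / x); [|lra].
assert (Hi := Rinv_0_lt_compat x Hx).
destruct (MVT_gen atan 0 (/ x) (fun t => / (1 + Rsqr t))) as (c & Hc & E).
- intros t _; apply is_derive_atan.
- intros t _; apply derivable_continuous_pt, derivable_pt_atan.
- rewrite atan_0, !Rminus_0_r in E; rewrite E.
  assert (Hc0 := Rle_0_sqr c).
  assert (/ (1 + Rsqr c) <= 1) by (rewrite <- Rinv_1; apply Rinv_le_contravar; lra).
  nra.
Qed.

Lemma norm_minus_triangle (V : CompleteNormedModule R_AbsRing) (x y z : V) :
  norm (minus x z) <= norm (minus x y) + norm (minus y z).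
Proof.
eapply Rle_trans; [|apply norm_triangle].
apply Req_le; f_equal; apply (minus_trans (G := V)).
Qed.

(** The error splits into four parts, each kept within e/4: the two integrals outside the window
    [t0 - d, t0 + d], the replacement of the kernel and of g by the Poisson kernel and g t0 inside
    it, and the Poisson mass missing from 2 pi. *)
Lemma jump_kernel_integral_near (X : qbanach) (j : quat) (hj : imag_unit j)
    (z v : R -> C) (g : R -> X) (a t0 b d0 : R) :
  a < t0 < b -> (forall t, ccont z t) -> (forall t, ccont v t) ->
  (forall t, continuous g t) ->
  (forall t, a <= t <= b -> t <> t0 -> z t <> z t0) ->
  v t0 <> RtoC 0 ->
  (forall eta, 0 < eta -> exists d, 0 < d /\ forall t, Rabs (t - t0) < d ->
     Cmod (z t - z t0 - RtoC (t - t0) * v t0) <= eta * Rabs (t - t0) /\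
     Cmod (v t - v t0) <= eta) ->
  0 < d0 ->
  (forall eps t, 0 < eps < d0 ->
     ((z t - z t0) * (z t - z t0) + RtoC eps * v t0 * (RtoC eps * v t0))%C <> RtoC 0) ->
  filterlim (fun eps =>
      RInt (fun t => lact (slice_pt j (jump_kernel (z t0) (v t0) eps (z t) (v t))) (g t)) a b)
    (at_right 0) (locally (scal (2 * PI) (g t0) : X)).
Proof.
intros Hab Hz Hv Hg Hne Hv0 Hder Hd0 Hnz.
set (h := fun eps t => lact (slice_pt j (jump_kernel (z t0) (v t0) eps (z t) (v t))) (g t)).
assert (Hm : 0 < Cmod (v t0)) by now apply Cmod_gt_0.
assert (Hex : forall eps x y, 0 < eps < d0 -> ex_RInt (h eps) x y).
{ intros eps x y He; apply ex_RInt_continuous; intros t _.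
  apply continuous_lact_slice; auto; apply jump_kernel_cont; auto. }
apply (filterlim_at_right_0 X); intros e He.
set (G := norm (g t0) + 1).
assert (HG : 1 <= G) by (unfold G; assert (H := norm_ge_0 (g t0)); lra).
assert (HPI := PI_RGT_0).
(* The Poisson mass is at most 2 pi; it multiplies 16 eta G, from the error of the kernel, plus eta,
   from the oscillation of g. In [eta], the value 1/4 is the limit allowed by [jump_kernel_near]. *)
set (B := 2 * PI * (16 * G + 1)).
assert (HB : 0 < B) by (unfold B; apply Rmult_lt_0_compat; lra).
set (eta := Rmin (1 / 4) (e / 4 / B)).
assert (Heta : 0 < eta /\ eta <= 1 / 4 /\ eta * B <= e / 4).
{ assert (0 < e / 4 / B) by (apply Rdiv_lt_0_compat; lra).
  unfold eta; repeat split; [apply Rmin_pos; lra|apply Rmin_l|].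
  apply Rle_div_r; [assumption|apply Rmin_r]. }
clearbody eta.
destruct (Hder (eta * Cmod (v t0))) as (d1 & Hd1 & Hder1).
{ apply Rmult_lt_0_compat; lra. }
assert (Hgc : exists d, 0 < d /\ forall t, Rabs (t - t0) < d ->
  norm (minus (g t) (g t0)) <= eta).
{ destruct (Hg t0 _ (locally_norm_lt X (g t0) eta (proj1 Heta))) as [d Hd].
  exists d; split; [apply cond_pos|].
  intros t Ht; apply Rlt_le, Hd, Ht. }
destruct Hgc as (d2 & Hd2 & Hgc).
set (d := Rmin (Rmin d1 d2) (Rmin (t0 - a) (b - t0)) / 2).
assert (Hd : 0 < d /\ d < d1 /\ d < d2 /\ d < t0 - a /\ d < b - t0).
{ unfold d.
  assert (H1 := Rmin_l d1 d2); assert (H2 := Rmin_r d1 d2).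
  assert (H3 := Rmin_l (t0 - a) (b - t0)); assert (H4 := Rmin_r (t0 - a) (b - t0)).
  assert (H5 := Rmin_l (Rmin d1 d2) (Rmin (t0 - a) (b - t0))).
  assert (H6 := Rmin_r (Rmin d1 d2) (Rmin (t0 - a) (b - t0))).
  assert (0 < Rmin (Rmin d1 d2) (Rmin (t0 - a) (b - t0))) by (repeat apply Rmin_pos; lra).
  lra. }
clearbody d; destruct Hd as (Hdp & Hdd1 & Hdd2 & Hda & Hdb).
assert (far : forall x y, x <= y -> (forall t, x <= t <= y -> a <= t <= b /\ t <> t0) ->
  exists d', 0 < d' /\ forall eps, 0 < eps < d' -> norm (RInt (h eps) x y) < e / 4).
{ intros x y Hxy Hin.
  destruct (proj1 (filterlim_at_right_0 X _ _)
    (jump_kernel_integral_far X j hj z v g (z t0) (v t0) x y d0 Hxy Hz Hv Hg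
      (fun t Ht => Hne t (proj1 (Hin t Ht)) (proj2 (Hin t Ht))) Hd0 Hnz)
    (e / 4) ltac:(lra)) as (d' & Hd' & Hfar).
  exists d'; split; [assumption|].
  intros eps Heps; specialize (Hfar eps Heps).
  now rewrite (norm_minus_zero X) in Hfar. }
destruct (far a (t0 - d)) as (d3 & Hd3 & Hfar1); [lra| |].
{ intros t Ht; split; [lra|]; intros ->; lra. }
destruct (far (t0 + d) b) as (d4 & Hd4 & Hfar2); [lra| |].
{ intros t Ht; split; [lra|]; intros ->; lra. }
clear far.
assert (near : forall eps, 0 < eps < d0 ->
  norm (minus (RInt (h eps) (t0 - d) (t0 + d))
     (scal (4 * atan (d / eps)) (g t0))) <= e / 4).
{ intros eps Heps.
  assert (Hpos : forall t, 0 < 2 * eps / ((t - t0) ^ 2 + eps ^ 2)).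
  { intros t; assert (H := pow2_ge_0 (t - t0)); assert (H' := pow_lt eps 2 (proj1 Heps)).
    apply Rdiv_lt_0_compat; lra. }
  apply Rle_trans with (4 * atan (d / eps) * (eta * (16 * G + 1))).
  - eapply (norm_RInt_le (V := X)
      (fun t => minus (h eps t) (scal (2 * eps / ((t - t0) ^ 2 + eps ^ 2)) (g t0)))
      (fun t => 2 * eps / ((t - t0) ^ 2 + eps ^ 2) * (eta * (16 * G + 1)))).
    4: apply (poisson_integral R_CompleteNormedModule), Heps.
    3: apply (is_RInt_minus (V := X));
         [apply RInt_correct, Hex, Heps|apply poisson_integral, Heps].
    { lra. }
    intros t Ht.
    assert (Htd : Rabs (t - t0) <= d) by (apply Rabs_le; lra).
    destruct (Hder1 t) as [Hd1t Hd2t]; [lra|].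
    assert (Hgt := Hgc t ltac:(lra)).
    assert (HK := jump_kernel_near (z t0) (v t0) (z t) (v t) eps (t - t0) eta
      Hv0 (proj1 Heps) ltac:(lra) Hd1t Hd2t).
    specialize (Hpos t); set (k := 2 * eps / ((t - t0) ^ 2 + eps ^ 2)) in *.
    eapply Rle_trans.
    { apply norm_minus_triangle with (y := scal k (g t)). }
    rewrite <- (scal_minus_distr_l (V := X)).
    unfold h; rewrite <- (lact_real X k (g t)), <- (slice_pt_real j k), <- (lact_minus_l X),
      <- slice_pt_minus, norm_lact, norm_slice_pt by assumption.
    assert (Hk : norm (scal k (minus (g t) (g t0))) <= k * eta).
    { eapply Rle_trans; [apply (norm_scal (V := X))|].
      change (abs k) with (Rabs k); rewrite Rabs_pos_eq by lra.
      apply Rmult_le_compat_l; lra. }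
    assert (HgG : norm (g t) <= G).
    { assert (H := norm_minus_triangle X (g t) (g t0) zero).
      rewrite !(norm_minus_zero X) in H; unfold G; lra. }
    assert (HKg : Cmod (jump_kernel (z t0) (v t0) eps (z t) (v t) - RtoC k) * norm (g t)
      <= 16 * eta * k * G).
    { apply Rmult_le_compat; try apply Cmod_ge_0; try apply norm_ge_0; assumption. }
    eapply Rle_trans; [exact (Rplus_le_compat _ _ _ _ HKg Hk)|lra].
  - assert (Ha := atan_bound (d / eps)).
    apply Rle_trans with (2 * PI * (eta * (16 * G + 1))).
    + apply Rmult_le_compat_r; [apply Rmult_le_pos|]; lra.
    + unfold B in Heta; lra. }
(* The missing mass, at most 4 eps/d, times the norm of g t0, at most G, is then at most e/4. *)
set (d5 := e * d / (16 * G)).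
assert (Hd5 : 0 < d5).
{ unfold d5; apply Rdiv_lt_0_compat; [apply Rmult_lt_0_compat|]; lra. }
exists (Rmin (Rmin d0 d5) (Rmin d3 d4)); split.
{ repeat apply Rmin_pos; assumption. }
intros eps [He0 He1].
assert (He2 : eps < d0 /\ eps < d5 /\ eps < d3 /\ eps < d4).
{ repeat split; apply Rlt_le_trans with (1 := He1).
  - eapply Rle_trans; [apply Rmin_l|apply Rmin_l].
  - eapply Rle_trans; [apply Rmin_l|apply Rmin_r].
  - eapply Rle_trans; [apply Rmin_r|apply Rmin_l].
  - eapply Rle_trans; [apply Rmin_r|apply Rmin_r]. }
clear He1; destruct He2 as (He1 & He2 & He3 & He4).
fold (h eps).
rewrite <- (RInt_Chasles (h eps) a (t0 - d) b) by now apply Hex.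
rewrite <- (RInt_Chasles (h eps) (t0 - d) (t0 + d) b) by now apply Hex.
specialize (Hfar1 eps (conj He0 He3)); specialize (Hfar2 eps (conj He0 He4)).
specialize (near eps (conj He0 He1)).
set (I1 := RInt (h eps) a (t0 - d)) in *; set (I2 := RInt (h eps) (t0 - d) (t0 + d)) in *.
set (I3 := RInt (h eps) (t0 + d) b) in *.
assert (Hatan : norm (minus (scal (4 * atan (d / eps)) (g t0)) (scal (2 * PI) (g t0)))
  <= e / 4).
{ rewrite <- (scal_minus_distr_r (V := X)).
  eapply Rle_trans; [apply (norm_scal (V := X))|].
  assert (Ha := atan_near_PI2 (d / eps) (Rdiv_lt_0_compat _ _ Hdp He0)).
  rewrite Rinv_div in Ha.
  change (Rabs (4 * atan (d / eps) - 2 * PI) * norm (g t0) <= e / 4).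
  rewrite Rabs_minus_sym, Rabs_pos_eq by lra.
  assert (Hed : eps / d <= e / (16 * G)).
  { apply Rle_div_l; [assumption|].
    replace (e / (16 * G) * d) with d5 by (unfold d5; field; lra); lra. }
  apply Rle_trans with (4 * (e / (16 * G)) * G).
  - apply Rmult_le_compat; [lra|apply norm_ge_0|lra|unfold G; lra].
  - apply Req_le; field; lra. }
assert (Hsplit : minus (plus I1 (plus I2 I3)) (scal (2 * PI) (g t0))
  = plus I1 (plus I3 (minus I2 (scal (2 * PI) (g t0))))).
{ unfold minus; rewrite <- !plus_assoc; f_equal.
  now rewrite plus_assoc, (plus_comm I2), <- plus_assoc. }
eapply Rle_lt_trans; [exact (Req_le _ _ (f_equal norm Hsplit))|].
assert (H := norm_minus_triangle X I2 (scal (4 * atan (d / eps)) (g t0))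
  (scal (2 * PI) (g t0))).
assert (H' := norm_triangle (V := X) I3 (minus I2 (scal (2 * PI) (g t0)))).
eapply Rle_lt_trans; [apply (norm_triangle (V := X))|].
apply Rlt_le_trans with (e / 4 + (e / 4 + (e / 4 + e / 4))); [|lra].
apply Rplus_lt_le_compat; [exact Hfar1|].
apply Rle_trans with (1 := H').
apply Rplus_le_compat; [exact (Rlt_le _ _ Hfar2)|].
apply Rle_trans with (1 := H).
now apply Rplus_le_compat.
Qed.

(* Extends functions on [a, b] to the line by their end values: Coquelicot's
   integrability criteria ask for two-sided continuity at the end points. *)
Definition clamp (a b t : R) : R := Rmax a (Rmin b t).

Lemma clamp_in (a b t : R) : a <= b -> a <= clamp a b t <= b.
Proof. intros H; unfold clamp, Rmax, Rmin; repeat destruct Rle_dec; lra. Qed.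

Lemma clamp_id (a b t : R) : a <= t <= b -> clamp a b t = t.
Proof. intros H; unfold clamp, Rmax, Rmin; repeat destruct Rle_dec; lra. Qed.

Lemma clamp_lipschitz (a b s t : R) :
  Rabs (clamp a b s - clamp a b t) <= Rabs (s - t).
Proof.
unfold clamp, Rmax, Rmin, Rabs; repeat destruct Rle_dec;
  repeat destruct Rcase_abs; lra.
Qed.

Definition cont_within {T : UniformSpace} (a b : R) (h : R -> T) : Prop :=
  forall t, a <= t <= b ->
    filterlim h (within (fun s => a <= s <= b) (locally t)) (locally (h t)).

Lemma continuous_clamp {T : UniformSpace} (a b : R) (h : R -> T) :
  a <= b -> cont_within a b h ->
  forall t, continuous (fun s => h (clamp a b s)) t.
Proof.
intros Hab H t P HP.
destruct (H _ (clamp_in a b t Hab) P HP) as [d Hd].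
exists d; intros s Hs; apply Hd; [|now apply clamp_in].
apply Rle_lt_trans with (1 := clamp_lipschitz a b s t), Hs.
Qed.

Lemma ccont_of_continuous (k : R -> C) (t : R) :
  continuous (U := C_UniformSpace) k t -> ccont k t.
Proof.
intros H; split.
- apply filterlim_comp with (1 := H).
  destruct (k t) as [x y]; apply (continuous_fst (U := R_UniformSpace) (V := R_UniformSpace)).
- apply filterlim_comp with (1 := H).
  destruct (k t) as [x y]; apply (continuous_snd (U := R_UniformSpace) (V := R_UniformSpace)).
Qed.

Lemma locally_Cmod_lt (z : C) (e : R) :
  0 < e -> locally (T := C_UniformSpace) z (fun w => Cmod (w - z) < e).
Proof.
intros He.
apply filter_imp with (2 := locally_norm_lt
  (prod_NormedModule R_AbsRing R_NormedModule R_NormedModule) z e He).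
intros w Hw; rewrite Cmod_norm; exact Hw.
Qed.

(** Clearing the denominator of the difference quotient makes the estimate hold at s = t too, a
    point that [derive_within] leaves out. *)
Lemma derive_within_bound (D : R -> Prop) (g : R -> C) (t : R) (l : C) :
  derive_within D g t l ->
  forall eta, 0 < eta -> exists d, 0 < d /\ forall s, D s -> Rabs (s - t) < d ->
    Cmod (g s - g t - RtoC (s - t) * l) <= eta * Rabs (s - t).
Proof.
intros H eta He.
destruct (H _ (locally_Cmod_lt l eta He)) as [d Hd].
exists d; split; [apply cond_pos|].
intros s Hs Hst.
destruct (Req_dec s t) as [->|Hne].
{ rewrite Rminus_diag, Rabs_R0, Rmult_0_r.
  replace (g t - g t - RtoC 0 * l)%C with (RtoC 0) by ring.
  rewrite Cmod_0; lra. }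
specialize (Hd s Hst Hne Hs); simpl in Hd.
assert (H0 : RtoC (s - t) <> RtoC 0) by (intros E; apply RtoC_inj in E; lra).
replace (g s - g t - RtoC (s - t) * l)%C
  with (((g s - g t) / RtoC (s - t) - l) * RtoC (s - t))%C by (field; assumption).
rewrite Cmod_mult, Cmod_R; apply Rmult_le_compat_r; [apply Rabs_pos|lra].
Qed.

Lemma derive_within_cont (a b : R) (g v : R -> C) :
  (forall t, a <= t <= b -> derive_within (fun s => a <= s <= b) g t (v t)) ->
  cont_within (T := C_UniformSpace) a b g.
Proof.
intros H t Ht.
(* With eta = 1, the increment g s - g t is at most (1 + |v t|) |s - t|, which dictates the radius
   chosen below. *)
destruct (derive_within_bound _ _ _ _ (H t Ht) 1 Rlt_0_1) as (d & Hd & Hb).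
apply filterlim_locally; intros e.
assert (Hv := Cmod_ge_0 (v t)).
assert (Hd' : 0 < Rmin d (e / (1 + Cmod (v t)))).
{ apply Rmin_pos; [assumption|]; apply Rdiv_lt_0_compat; [apply cond_pos|lra]. }
exists (mkposreal _ Hd'); intros s Hs Hab.
change (Rabs (s - t) < Rmin d (e / (1 + Cmod (v t)))) in Hs.
apply C_NormedModule_mixin_compat1.
change (Cmod (g s - g t) < e).
specialize (Hb s Hab (Rlt_le_trans _ _ _ Hs (Rmin_l _ _))).
assert (Hs2 := Rlt_le_trans _ _ _ Hs (Rmin_r _ _)).
apply Rlt_div_r in Hs2; [|lra].
apply Rle_lt_trans with (2 := Hs2).
replace (g s - g t)%C with ((g s - g t - RtoC (s - t) * v t) + RtoC (s - t) * v t)%C by ring.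
eapply Rle_trans; [apply Cmod_triangle|].
rewrite Cmod_mult, Cmod_R; lra.
Qed.

(** The kernel identities below hold only modulo i^2 = -1. They are proved with - i^2 kept as an
    explicit factor, hence for an indeterminate in place of i, and this equation then removes the
    factor. *)
Lemma opp_Ci_sqr : (- (Ci * Ci) = 1)%C.
Proof. unfold Ci, Cmult, Copp, RtoC; simpl; f_equal; ring. Qed.

Lemma jump_kernelE (z0 v0 s ds : C) (eps : R) :
  s <> (z0 + RtoC eps * (Ci * v0))%C -> s <> (z0 - RtoC eps * (Ci * v0))%C ->
  (- Ci * ds * / (s - (z0 + RtoC eps * (Ci * v0)))
   - - Ci * ds * / (s - (z0 - RtoC eps * (Ci * v0))))%C
  = jump_kernel z0 v0 eps s ds.
Proof.
intros H1 H2; apply Cminus_neq_0 in H1; apply Cminus_neq_0 in H2.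
unfold jump_kernel.
replace ((s - z0) * (s - z0) + RtoC eps * v0 * (RtoC eps * v0))%C
  with ((s - (z0 + RtoC eps * (Ci * v0))) * (s - (z0 - RtoC eps * (Ci * v0))))%C.
- rewrite RtoC_mult.
  transitivity (- (Ci * Ci) * (RtoC 2 * RtoC eps * v0 * ds)
    / ((s - (z0 + RtoC eps * (Ci * v0))) * (s - (z0 - RtoC eps * (Ci * v0)))))%C.
  + field; split; assumption.
  + rewrite opp_Ci_sqr, Cmult_1_l; reflexivity.
- transitivity ((s - z0) * (s - z0) + - (Ci * Ci) * (RtoC eps * v0 * (RtoC eps * v0)))%C;
    [ring|].
  now rewrite opp_Ci_sqr, Cmult_1_l.
Qed.

Lemma jump_den_neq_0 (z0 v0 s : C) (eps : R) :
  s <> (z0 + RtoC eps * (Ci * v0))%C -> s <> (z0 - RtoC eps * (Ci * v0))%C ->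
  ((s - z0) * (s - z0) + RtoC eps * v0 * (RtoC eps * v0))%C <> RtoC 0.
Proof.
intros H1 H2; apply Cminus_neq_0 in H1; apply Cminus_neq_0 in H2.
replace (RtoC eps * v0 * (RtoC eps * v0))%C
  with (- (Ci * Ci) * (RtoC eps * v0 * (RtoC eps * v0)))%C by now rewrite opp_Ci_sqr, Cmult_1_l.
replace ((s - z0) * (s - z0) + - (Ci * Ci) * (RtoC eps * v0 * (RtoC eps * v0)))%C
  with ((s - (z0 + RtoC eps * (Ci * v0))) * (s - (z0 - RtoC eps * (Ci * v0))))%C by ring.
now apply Cmult_neq_0.
Qed.

Definition C1_arc (a b : R) (p v : R -> C) : Prop :=
  a < b /\
  (forall t, a <= t <= b -> derive_within (fun s => a <= s <= b) p t (v t)) /\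
  cont_within (T := C_UniformSpace) a b v.

Lemma C1_arc_clamp (a b : R) (p v : R -> C) : C1_arc a b p v ->
  (forall t, ccont (fun s => p (clamp a b s)) t) /\
  (forall t, ccont (fun s => v (clamp a b s)) t).
Proof.
intros (Hab & Hp & Hv); split; intros t; apply ccont_of_continuous.
- apply (continuous_clamp (T := C_UniformSpace)); [lra|].
  now apply derive_within_cont with v.
- apply (continuous_clamp (T := C_UniformSpace)); [lra|assumption].
Qed.

Definition arc_jump (X : qbanach) (j : quat) (z0 v0 : C) (p v : R -> C)
    (F : C -> X) (a b eps : R) : X :=
  RInt (fun t => lact (slice_pt j (jump_kernel z0 v0 eps (p t) (v t))) (F (p t))) a b.

Lemma arc_jump_clamp (X : qbanach) (j : quat) (z0 v0 : C) (p v : R -> C)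
    (F : C -> X) (a b eps : R) : a < b ->
  arc_jump X j z0 v0 p v F a b eps =
  RInt (fun t => lact (slice_pt j (jump_kernel z0 v0 eps (p (clamp a b t)) (v (clamp a b t))))
                      (F (p (clamp a b t)))) a b.
Proof.
intros Hab; apply RInt_ext; intros t Ht.
rewrite Rmin_left, Rmax_right in Ht by lra.
now rewrite clamp_id by lra.
Qed.

(** The two points are the poles of [jump_kernel], placed on the normal i v0. Their avoiding S for
    every eps below d0 keeps the denominator of the kernel away from zero on S. *)
Definition off_normal (z0 v0 : C) (d0 : R) (S : C -> Prop) : Prop :=
  forall eps s, 0 < eps < d0 -> S s ->
    s <> (z0 + RtoC eps * (Ci * v0))%C /\ s <> (z0 - RtoC eps * (Ci * v0))%C.

Lemma arc_jump_far (X : qbanach) (j : quat) (hj : imag_unit j) (z0 v0 : C)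
    (p v : R -> C) (F : C -> X) (a b d0 : R) :
  C1_arc a b p v -> cont_within a b (fun t => F (p t)) ->
  (forall t, a <= t <= b -> p t <> z0) ->
  0 < d0 -> off_normal z0 v0 d0 (fun s => exists t, a <= t <= b /\ p t = s) ->
  filterlim (arc_jump X j z0 v0 p v F a b) (at_right 0) (locally (zero : X)).
Proof.
intros Harc HF Hne Hd0 Hoff.
destruct (C1_arc_clamp _ _ _ _ Harc) as [Hp Hv].
destruct Harc as (Hab & _ & _).
eapply filterlim_ext.
{ intros eps; symmetry; now apply arc_jump_clamp. }
apply (jump_kernel_integral_far X j hj (fun t => p (clamp a b t)) (fun t => v (clamp a b t))
  (fun t => F (p (clamp a b t))) z0 v0 a b d0); auto; [lra| | |].
- now apply (continuous_clamp a b (fun t => F (p t))); [lra|].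
- intros t Ht; rewrite clamp_id by assumption; auto.
- intros eps t Heps; apply jump_den_neq_0; apply (Hoff eps); auto;
    exists (clamp a b t); split; auto; apply clamp_in; lra.
Qed.

Lemma arc_jump_near (X : qbanach) (j : quat) (hj : imag_unit j)
    (p v : R -> C) (F : C -> X) (a t0 b d0 : R) :
  a < t0 < b ->
  C1_arc a b p v -> cont_within a b (fun t => F (p t)) ->
  (forall t, a <= t <= b -> t <> t0 -> p t <> p t0) ->
  v t0 <> RtoC 0 ->
  0 < d0 -> off_normal (p t0) (v t0) d0 (fun s => exists t, a <= t <= b /\ p t = s) ->
  filterlim (arc_jump X j (p t0) (v t0) p v F a b) (at_right 0)
    (locally (scal (2 * PI) (F (p t0)) : X)).
Proof.
intros Ht0 Harc HF Hne Hv0 Hd0 Hoff.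
destruct (C1_arc_clamp _ _ _ _ Harc) as [Hp Hv].
destruct Harc as (Hab & Hder & Hvc).
eapply filterlim_ext.
{ intros eps; symmetry; now apply arc_jump_clamp. }
assert (Hc0 : clamp a b t0 = t0) by (apply clamp_id; lra).
assert (H := jump_kernel_integral_near X j hj (fun t => p (clamp a b t)) (fun t => v (clamp a b t))
  (fun t => F (p (clamp a b t))) a t0 b d0 Ht0 Hp Hv); simpl in H.
rewrite Hc0 in H; apply H; clear H; auto.
- now apply (continuous_clamp a b (fun t => F (p t))); [lra|].
- intros t Ht Htt; rewrite clamp_id by assumption; auto.
- intros eta Heta.
  destruct (derive_within_bound _ _ _ _ (Hder t0 ltac:(lra)) eta Heta) as (d1 & Hd1 & H1).
  destruct (Hvc t0 ltac:(lra) _ (locally_Cmod_lt _ eta Heta)) as [d2 H2].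
  (* The last two terms keep t in [a, b], where [clamp] is the identity. As t0 is interior, the
     one-sided derivative at t0 thus becomes a two-sided one for the clamped path. *)
  exists (Rmin (Rmin d1 d2) (Rmin (t0 - a) (b - t0))); split.
  { repeat apply Rmin_pos; try lra; apply cond_pos. }
  intros t Ht.
  assert (Htb : Rabs (t - t0) < d1 /\ Rabs (t - t0) < d2 /\ Rabs (t - t0) < t0 - a
    /\ Rabs (t - t0) < b - t0).
  { repeat split; apply Rlt_le_trans with (1 := Ht).
    - eapply Rle_trans; [apply Rmin_l|apply Rmin_l].
    - eapply Rle_trans; [apply Rmin_l|apply Rmin_r].
    - eapply Rle_trans; [apply Rmin_r|apply Rmin_l].
    - eapply Rle_trans; [apply Rmin_r|apply Rmin_r]. }
  destruct Htb as (T1 & T2 & T3 & T4).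
  assert (Htab : a <= t <= b).
  { apply Rabs_lt_between in T3; apply Rabs_lt_between in T4; lra. }
  rewrite clamp_id by assumption; split; [now apply H1|].
  apply Rlt_le, H2; assumption.
- intros eps t Heps; apply jump_den_neq_0; apply (Hoff eps); auto;
    exists (clamp a b t); split; auto; apply clamp_in; lra.
Qed.

(** * The jump along the contour *)

Lemma minus_plus_plus (G : AbelianGroup) (a b c d : G) :
  minus (plus a b) (plus c d) = plus (minus a c) (minus b d).
Proof.
unfold minus; rewrite opp_plus, <- !plus_assoc; f_equal.
now rewrite !plus_assoc; f_equal; apply plus_comm.
Qed.

Lemma sum_n_minus (G : AbelianGroup) (u v : nat -> G) (n : nat) :
  minus (sum_n u n) (sum_n v n) = sum_n (fun k => minus (u k) (v k)) n.
Proof.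
induction n as [|n IH]; [now rewrite !sum_O|].
now rewrite !sum_Sn, <- IH, minus_plus_plus.
Qed.

Lemma filterlim_plus_eq (V : NormedModule R_AbsRing) (F : (R -> Prop) -> Prop)
    (HF : Filter F) (u v : R -> V) (a b l : V) :
  filterlim u F (locally a) -> filterlim v F (locally b) -> plus a b = l ->
  filterlim (fun e => plus (u e) (v e)) F (locally l).
Proof.
intros Hu Hv <-; apply filterlim_comp_2 with (1 := Hu) (2 := Hv).
apply (filterlim_plus (V := V)).
Qed.

Lemma filterlim_sum_n (V : NormedModule R_AbsRing) (F : (R -> Prop) -> Prop)
    (HF : Filter F) (u : nat -> R -> V) (l : nat -> V) (n : nat) :
  (forall k, (k <= n)%nat -> filterlim (u k) F (locally (l k))) ->
  filterlim (fun e => sum_n (fun k => u k e) n) F (locally (sum_n l n)).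
Proof.
induction n as [|n IH]; intros H.
- rewrite sum_O; eapply filterlim_ext; [|apply (H 0%nat); lia].
  now intros e; rewrite sum_O.
- rewrite sum_Sn; eapply filterlim_ext.
  { intros e; symmetry; apply sum_Sn. }
  eapply (filterlim_plus_eq V); [|apply IH; intros; apply H; lia|apply H; lia|].
  + assumption.
  + reflexivity.
Qed.

Lemma sum_n_single (G : AbelianGroup) (k0 n : nat) (x : G) :
  sum_n (fun k => if Nat.eq_dec k k0 then x else zero) n =
  if le_dec k0 n then x else zero.
Proof.
induction n as [|n IH].
- rewrite sum_O; destruct Nat.eq_dec, le_dec; auto; lia.
- rewrite sum_Sn, IH.
  destruct (Nat.eq_dec (S n) k0), (le_dec k0 n), (le_dec k0 (S n)); try lia.
  + apply plus_zero_l.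
  + apply plus_zero_r.
  + apply plus_zero_l.
Qed.

Lemma knot_mono (c : pcurve) :
  (forall k, (k <= nsub c)%nat -> knot c k < knot c (S k)) ->
  forall k l, (k <= l <= S (nsub c))%nat -> knot c k <= knot c l.
Proof.
intros H k l [Hkl Hl]; induction Hkl as [|l Hkl IH]; [lra|].
apply Rle_trans with (knot c l); [apply IH; lia|].
apply Rlt_le, H; lia.
Qed.

Lemma on_curve_arc (c : pcurve) (k : nat) (t : R) :
  (forall k, (k <= nsub c)%nat -> knot c k < knot c (S k)) ->
  (k <= nsub c)%nat -> knot c k <= t <= knot c (S k) -> on_curve c (path c t).
Proof.
intros H Hk Ht; exists t; split; [|reflexivity].
assert (H1 := knot_mono c H 0 k ltac:(lia)).
assert (H2 := knot_mono c H (S k) (S (nsub c)) ltac:(lia)).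
lra.
Qed.

Lemma knot_cover (c : pcurve) (t : R) (n : nat) :
  knot c 0 <= t <= knot c (S n) ->
  exists k, (k <= n)%nat /\ knot c k <= t <= knot c (S k).
Proof.
induction n as [|n IH]; intros Ht; [exists 0%nat; auto|].
destruct (Rle_dec t (knot c (S n))) as [h|h].
- destruct IH as (k & Hk & Hkt); [lra|]; exists k; split; [lia|assumption].
- exists (S n); split; [lia|lra].
Qed.

Lemma closed_pw_C1_arc (c : pcurve) (k : nat) : closed_pw_C1 c ->
  (k <= nsub c)%nat -> C1_arc (knot c k) (knot c (S k)) (path c) (vel c k).
Proof.
intros [H _] Hk; destruct (H k Hk) as [Hkn Harc]; repeat split.
- assumption.
- intros t Ht; apply (Harc t Ht).
- intros t Ht; apply (Harc t Ht).
Qed.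

Lemma closed_pw_C1_knot (c : pcurve) : closed_pw_C1 c ->
  forall k, (k <= nsub c)%nat -> knot c k < knot c (S k).
Proof. intros [H _] k Hk; apply (H k Hk). Qed.

(** [simple_closed] leaves out the last parameter, whose point is that of the first one. Being
    interior to an arc, t0 differs from both, so injectivity still applies. *)
Lemma simple_closed_arc (c : pcurve) (k0 : nat) (t0 t : R) :
  closed_pw_C1 c -> simple_closed c ->
  (k0 <= nsub c)%nat -> knot c k0 < t0 < knot c (S k0) ->
  knot c 0 <= t <= knot c (S (nsub c)) -> t <> t0 -> path c t <> path c t0.
Proof.
intros Hc Hs Hk0 Ht0 Ht Hne E.
assert (Hkn := closed_pw_C1_knot c Hc).
assert (H1 := knot_mono c Hkn 0 k0 ltac:(lia)).
assert (H2 := knot_mono c Hkn (S k0) (S (nsub c)) ltac:(lia)).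
destruct (Req_dec t (knot c (S (nsub c)))) as [->|Hne'].
- destruct Hc as (_ & Hcl & _); rewrite Hcl in E.
  apply Hs in E; lra.
- apply Hs in E; lra.
Qed.

(** The Cauchy integrand in the complex coordinate of the slice; the factor [- Ci] is the -j of ds_j
    = -j ds. *)
Definition cauchy_arc (X : qbanach) (j : quat) (F : C -> X) (p v : R -> C)
    (w : C) (t : R) : X :=
  lact (slice_pt j (- Ci * v t * / (p t - w))%C) (F (p t)).

Lemma ex_RInt_cauchy_arc (X : qbanach) (j : quat) (F : C -> X)
    (p v : R -> C) (w : C) (a b : R) :
  C1_arc a b p v -> cont_within a b (fun t => F (p t)) ->
  (forall t, a <= t <= b -> p t <> w) ->
  ex_RInt (cauchy_arc X j F p v w) a b.
Proof.
intros Harc HF Hne.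
destruct (C1_arc_clamp _ _ _ _ Harc) as [Hp Hv].
destruct Harc as (Hab & _ & _).
apply ex_RInt_ext with (fun t => cauchy_arc X j F p v w (clamp a b t)).
{ intros t Ht; rewrite Rmin_left, Rmax_right in Ht by lra.
  now rewrite clamp_id by lra. }
apply ex_RInt_continuous; intros t _; unfold cauchy_arc.
apply continuous_lact_slice.
- apply ccont_mult.
  + now apply ccont_mult; [apply ccont_const|].
  + apply ccont_inv; [now apply ccont_minus; [|apply ccont_const]|].
    apply Cminus_neq_0, Hne, clamp_in; lra.
- now apply (continuous_clamp a b (fun t => F (p t))); [lra|].
Qed.

Lemma cauchy_arc_jump (X : qbanach) (j : quat) (F : C -> X)
    (p v : R -> C) (z0 v0 : C) (a b eps : R) :
  C1_arc a b p v -> cont_within a b (fun t => F (p t)) ->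
  (forall t, a <= t <= b -> p t <> (z0 + RtoC eps * (Ci * v0))%C /\
     p t <> (z0 - RtoC eps * (Ci * v0))%C) ->
  minus (RInt (cauchy_arc X j F p v (z0 + RtoC eps * (Ci * v0))%C) a b)
        (RInt (cauchy_arc X j F p v (z0 - RtoC eps * (Ci * v0))%C) a b)
  = arc_jump X j z0 v0 p v F a b eps.
Proof.
intros Harc HF Hne.
rewrite <- (RInt_minus (V := X)) by (apply ex_RInt_cauchy_arc; auto; intros; now apply Hne).
apply RInt_ext; intros t Ht.
destruct Harc as (Hab & _ & _).
rewrite Rmin_left, Rmax_right in Ht by lra.
unfold cauchy_arc; rewrite <- (lact_minus_l X), <- slice_pt_minus.
now rewrite jump_kernelE by (apply Hne; lra).
Qed.

Lemma curve_integral_slice (X : qbanach) (j : quat) (hj : imag_unit j)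
    (f : quat -> X) (w : C) (c : pcurve) :
  closed_pw_C1 c ->
  (forall s, on_curve c s -> s <> w /\ s <> Cconj w) ->
  curve_integral X j f (slice_pt j w) c =
  sum_n (fun k => RInt (cauchy_arc X j (fun s => f (slice_pt j s)) (path c) (vel c k) w)
                    (knot c k) (knot c (S k))) (nsub c).
Proof.
intros Hc Hw; assert (Hkn := closed_pw_C1_knot c Hc).
apply sum_n_ext_loc; intros k Hk.
apply RInt_ext; intros t Ht.
specialize (Hkn k Hk).
rewrite Rmin_left, Rmax_right in Ht by lra.
destruct (Hw (path c t)) as [H1 H2].
{ apply on_curve_arc with k; [apply closed_pw_C1_knot|..]; auto; lra. }
unfold cauchy_arc; rewrite SLinv_slice by assumption.
rewrite <- (slice_pt_Ci j) at 2.
rewrite <- slice_pt_opp, !slice_pt_mul by assumption.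
f_equal; f_equal; ring.
Qed.

Definition curve_jump (X : qbanach) (j : quat) (f : quat -> X) (z0 v0 : C)
    (c : pcurve) (eps : R) : X :=
  sum_n (fun k => arc_jump X j z0 v0 (path c) (vel c k)
    (fun s => f (slice_pt j s)) (knot c k) (knot c (S k)) eps) (nsub c).

Definition cont_along (X : qbanach) (F : C -> X) (c : pcurve) : Prop :=
  forall k, (k <= nsub c)%nat ->
    cont_within (knot c k) (knot c (S k)) (fun t => F (path c t)).

Lemma curve_integral_jump (X : qbanach) (j : quat) (hj : imag_unit j)
    (f : quat -> X) (z0 v0 : C) (c : pcurve) (eps : R) :
  closed_pw_C1 c -> cont_along X (fun s => f (slice_pt j s)) c ->
  (forall s w, on_curve c s ->
     w = (z0 + RtoC eps * (Ci * v0))%C \/ w = (z0 - RtoC eps * (Ci * v0))%C ->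
     s <> w /\ s <> Cconj w) ->
  minus (curve_integral X j f (slice_pt j (z0 + RtoC eps * (Ci * v0))%C) c)
        (curve_integral X j f (slice_pt j (z0 - RtoC eps * (Ci * v0))%C) c)
  = curve_jump X j f z0 v0 c eps.
Proof.
intros Hc HF Hw.
rewrite !curve_integral_slice by eauto.
rewrite (sum_n_minus (CompleteNormedModule.AbelianGroup _ X)).
apply sum_n_ext_loc; intros k Hk.
apply cauchy_arc_jump; [now apply closed_pw_C1_arc|now apply HF|].
intros t Ht.
assert (Hon := on_curve_arc c k t (closed_pw_C1_knot c Hc) Hk Ht).
split; apply (Hw _ _ Hon); auto.
Qed.

Lemma curve_jump_far (X : qbanach) (j : quat) (hj : imag_unit j)
    (f : quat -> X) (z0 v0 : C) (c : pcurve) (d0 : R) :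
  closed_pw_C1 c -> cont_along X (fun s => f (slice_pt j s)) c ->
  ~ on_curve c z0 ->
  0 < d0 -> off_normal z0 v0 d0 (on_curve c) ->
  filterlim (curve_jump X j f z0 v0 c) (at_right 0) (locally (zero : X)).
Proof.
intros Hc HF Hz Hd0 Hoff.
assert (Hon := fun k t => on_curve_arc c k t (closed_pw_C1_knot c Hc)).
replace (zero : X) with (sum_n (fun _ => zero : X) (nsub c)).
2: { clear; induction (nsub c) as [|n IH]; [apply sum_O|].
     rewrite sum_Sn, IH; apply (plus_zero_l (G := X)). }
apply (filterlim_sum_n X _ _ (fun k => arc_jump X j z0 v0 (path c) (vel c k)
    (fun s => f (slice_pt j s)) (knot c k) (knot c (S k)))).
intros k Hk; apply arc_jump_far with d0; auto.
- now apply closed_pw_C1_arc.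
- intros t Ht E; apply Hz; rewrite <- E; eauto.
- intros eps s Heps (t & Ht & <-); apply Hoff; eauto.
Qed.

Lemma curve_jump_near (X : qbanach) (j : quat) (hj : imag_unit j)
    (f : quat -> X) (c : pcurve) (k0 : nat) (t0 d0 : R) :
  closed_pw_C1 c -> simple_closed c -> cont_along X (fun s => f (slice_pt j s)) c ->
  (k0 <= nsub c)%nat -> knot c k0 < t0 < knot c (S k0) ->
  0 < d0 -> off_normal (path c t0) (vel c k0 t0) d0 (on_curve c) ->
  filterlim (curve_jump X j f (path c t0) (vel c k0 t0) c) (at_right 0)
    (locally (scal (2 * PI) (f (slice_pt j (path c t0))) : X)).
Proof.
intros Hc Hs HF Hk0 Ht0 Hd0 Hoff.
assert (Hkn := closed_pw_C1_knot c Hc).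
assert (Hon := fun k t => on_curve_arc c k t Hkn).
set (L := scal (2 * PI) (f (slice_pt j (path c t0))) : X).
(* Only the arc k0 passes through the point. Writing the limit as a sum with a single nonzero term
   lets the limits be taken arc by arc. *)
replace L with (sum_n (fun k => if Nat.eq_dec k k0 then L else zero) (nsub c)).
2: { rewrite (sum_n_single (CompleteNormedModule.AbelianGroup _ X)).
     destruct le_dec; [reflexivity|contradiction]. }
apply (filterlim_sum_n X _ _ (fun k => arc_jump X j (path c t0) (vel c k0 t0)
    (path c) (vel c k) (fun s => f (slice_pt j s)) (knot c k) (knot c (S k)))).
assert (Hin : forall k t, (k <= nsub c)%nat -> knot c k <= t <= knot c (S k) ->
  knot c 0 <= t <= knot c (S (nsub c))).
{ intros k t Hk Ht.
  assert (H1 := knot_mono c Hkn 0 k ltac:(lia)).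
  assert (H2 := knot_mono c Hkn (S k) (S (nsub c)) ltac:(lia)); lra. }
intros k Hk; destruct (Nat.eq_dec k k0) as [->|Hne].
- apply arc_jump_near with d0; auto.
  + now apply closed_pw_C1_arc.
  + intros t Ht Htt; apply simple_closed_arc with k0; eauto.
  + destruct Hc as [Hc _]; apply (Hc k0 Hk0); lra.
  + intros eps s Heps (t & Ht & <-); apply Hoff; eauto.
- apply arc_jump_far with d0; auto.
  + now apply closed_pw_C1_arc.
  + intros t Ht; apply simple_closed_arc with k0; eauto.
    (* The parameter interval of another arc lies entirely on one side of the open interval
       containing t0, so it cannot contain t0. *)
    intros ->; destruct (Nat.lt_total k k0) as [h|[h|h]]; [|lia|].
    * assert (H := knot_mono c Hkn (S k) k0 ltac:(lia)); lra.
    * assert (H := knot_mono c Hkn (S k0) k ltac:(lia)); lra.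
  + intros eps s Heps (t & Ht & <-); apply Hoff; eauto.
Qed.

Lemma fold_plus_minus (G : AbelianGroup) (A : Type) (u v : A -> G) (l : list A) :
  minus (fold_right (fun c x => plus (u c) x) zero l)
        (fold_right (fun c x => plus (v c) x) zero l)
  = fold_right (fun c x => plus (minus (u c) (v c)) x) zero l.
Proof.
induction l as [|c l IH]; simpl; [apply minus_eq_zero|].
etransitivity; [apply minus_plus_plus|]; exact (f_equal (plus _) IH).
Qed.

Lemma fold_plus_ext (G : AbelianGroup) (A : Type) (u v : A -> G) (l : list A) :
  (forall c, In c l -> u c = v c) ->
  fold_right (fun c x => plus (u c) x) zero l
  = fold_right (fun c x => plus (v c) x) zero l.
Proof.
induction l as [|c l IH]; simpl; intros H; [reflexivity|].
apply (f_equal2 plus); auto.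
Qed.

Lemma curves_jump_far (X : qbanach) (j : quat) (hj : imag_unit j)
    (f : quat -> X) (z0 v0 : C) (d0 : R) (cs : list pcurve) :
  (forall c, In c cs -> closed_pw_C1 c /\ cont_along X (fun s => f (slice_pt j s)) c /\
     ~ on_curve c z0 /\ off_normal z0 v0 d0 (on_curve c)) ->
  0 < d0 ->
  filterlim (fun eps => fold_right (fun c x => plus (curve_jump X j f z0 v0 c eps) x) zero cs)
    (at_right 0) (locally (zero : X)).
Proof.
intros H Hd0; induction cs as [|c cs IH]; simpl; [apply filterlim_const|].
destruct (H c (or_introl eq_refl)) as (H1 & H2 & H3 & H4).
eapply (filterlim_plus_eq X);
  [typeclasses eauto|now apply curve_jump_far with d0| |apply (plus_zero_l (G := X))].
apply IH; intros c' Hc'; apply H; now right.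
Qed.

(** Disjointness leaves [c0] as the only curve through the point; every other curve contributes zero
    in the limit. *)
Lemma curves_jump (X : qbanach) (j : quat) (hj : imag_unit j)
    (f : quat -> X) (cs : list pcurve) (c0 : pcurve) (k0 : nat) (t0 d0 : R) :
  ForallOrdPairs (fun c1 c2 => forall z, ~ (on_curve c1 z /\ on_curve c2 z)) cs ->
  In c0 cs -> (k0 <= nsub c0)%nat -> knot c0 k0 < t0 < knot c0 (S k0) ->
  (forall c, In c cs -> closed_pw_C1 c /\ simple_closed c /\
     cont_along X (fun s => f (slice_pt j s)) c /\
     off_normal (path c0 t0) (vel c0 k0 t0) d0 (on_curve c)) ->
  0 < d0 ->
  filterlim (fun eps => fold_right
      (fun c x => plus (curve_jump X j f (path c0 t0) (vel c0 k0 t0) c eps) x) zero cs)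
    (at_right 0) (locally (scal (2 * PI) (f (slice_pt j (path c0 t0))) : X)).
Proof.
intros Hdisj Hin Hk0 Ht0 H Hd0.
assert (Hon : on_curve c0 (path c0 t0)).
{ apply on_curve_arc with k0; auto; [|lra].
  apply closed_pw_C1_knot, (H c0 Hin). }
induction Hdisj as [|c cs Hc Hcs IH]; simpl; [destruct Hin|].
set (L := scal (2 * PI) (f (slice_pt j (path c0 t0))) : X).
destruct (H c (or_introl eq_refl)) as (H1 & H2 & H3 & H4).
rewrite Forall_forall in Hc.
destruct Hin as [<-|Hin].
- eapply (filterlim_plus_eq X);
    [typeclasses eauto|now apply curve_jump_near with d0| |apply (plus_zero_r (G := X))].
  apply curves_jump_far with d0; auto.
  intros c' Hc'; destruct (H c' (or_intror Hc')) as (G1 & G2 & G3 & G4).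
  split; [|split; [|split]]; auto.
  intros Hc'0; apply (Hc c' Hc' (path c t0)); now split.
- eapply (filterlim_plus_eq X);
    [typeclasses eauto|apply curve_jump_far with d0; auto| |apply (plus_zero_l (G := X))].
  + intros Hc'0; apply (Hc c0 Hin (path c0 t0)); now split.
  + apply IH; auto; intros c' Hc'; apply H; now right.
Qed.

(** * Slices of axially symmetric sets *)

Lemma closure_norm (V : NormedModule R_AbsRing) (A : V -> Prop) (x : V) :
  closure A x <-> forall e, 0 < e -> exists y, norm (minus y x) < e /\ A y.
Proof.
split.
- intros H e He.
  destruct (locally_norm_lt V x e He) as [d Hd].
  destruct (H d) as (y & Hy & HA); exists y; split; auto.
- intros H e; destruct (H e (cond_pos e)) as (y & Hy & HA).
  exists y; split; [now apply norm_compat1|assumption].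
Qed.

Lemma closure_Cmod (A : C -> Prop) (z : C) :
  closure (T := C_UniformSpace) A z <->
  forall e, 0 < e -> exists w, Cmod (w - z) < e /\ A w.
Proof.
split.
- intros H e He.
  destruct (locally_Cmod_lt z e He) as [d Hd].
  destruct (H d) as (w & Hw & HA); exists w; split; auto.
- intros H e; destruct (H e (cond_pos e)) as (w & Hw & HA).
  exists w; split; [now apply C_NormedModule_mixin_compat1|assumption].
Qed.

Lemma closure_subset {T : UniformSpace} (A : T -> Prop) (x : T) :
  A x -> closure A x.
Proof. intros H e; exists x; split; [apply ball_center|assumption]. Qed.

Lemma open_boundary {T : UniformSpace} (A : T -> Prop) (x : T) :
  open A -> boundary A x -> ~ A x.
Proof.
intros HA [_ H] Hx; destruct (HA x Hx) as [e He].
destruct (H e) as (y & Hy & HnA); exact (HnA (He y Hy)).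
Qed.

Lemma norm_slice_minus (j : quat) (z w : C) : imag_unit j ->
  norm (minus (slice_pt j z) (slice_pt j w)) = Cmod (z - w).
Proof. now intros Hj; rewrite <- slice_pt_minus, norm_slice_pt. Qed.

Lemma imag_unit_opp (j : quat) : imag_unit j -> imag_unit (opp j).
Proof.
intros Hj; split.
- destruct (imag_unit_coord _ Hj) as (b & c & d & -> & _); rewrite quat_opp; simpl; lra.
- rewrite <- (slice_pt_Ci j), <- slice_pt_opp, norm_slice_pt, Cmod_opp by assumption.
  rewrite <- (norm_slice_pt j), slice_pt_Ci by assumption; apply Hj.
Qed.

Lemma slice_pt_opp_unit (j : quat) (z : C) :
  slice_pt (opp j) z = slice_pt j (Cconj z).
Proof.
destruct j as [[[a b] c] d], z as [x y]; unfold Cconj; simpl fst; simpl snd.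
rewrite quat_opp, !slice_pt_quat; apply quat_eq; ring.
Qed.

Lemma Cmod_conj_minus (z w : C) : Cmod (Cconj z - Cconj w) = Cmod (z - w).
Proof. now rewrite <- Cminus_conj, Cmod_conj. Qed.

(** The sphere [q] meets C_j in these two conjugate points, which coincide when q is real. The
    second one is reached with the imaginary unit -j. *)
Lemma slice_repr (U : quat -> Prop) (j : quat)
    (hU : axially_symmetric U) (hj : imag_unit j) (q : quat) : U q ->
  slice j U (qRe q, norm (qIm q)) /\ slice j U (qRe q, - norm (qIm q)).
Proof.
intros Hq; split; apply hU with (1 := Hq).
- now exists j.
- exists (opp j); split; [now apply imag_unit_opp|].
  rewrite slice_pt_opp_unit; reflexivity.
Qed.

Lemma slice_conj (U : quat -> Prop) (j : quat)
    (hU : axially_symmetric U) (hj : imag_unit j) (z : C) :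
  slice j U z -> slice j U (Cconj z).
Proof.
intros Hz; apply (slice_repr U j hU hj) in Hz.
rewrite qRe_slice_pt in Hz by assumption.
(* As |j| = 1, the imaginary part of u + j v has norm |v|; depending on the sign of v, one or the
   other representative is the conjugate of z. *)
replace (norm (qIm (slice_pt j z))) with (Rabs (snd z)) in Hz.
- destruct z as [x y]; unfold Cconj; simpl in *.
  unfold Rabs in Hz; destruct Rcase_abs; [apply Hz|apply Hz].
- destruct (imag_unit_coord _ hj) as (b & c & d & -> & H).
  destruct z as [x y]; rewrite slice_pt_coord; simpl qIm; rewrite norm_quat; simpl snd.
  rewrite <- sqrt_Rsqr_abs; f_equal; unfold Rsqr.
  transitivity (y * y * (b ^ 2 + c ^ 2 + d ^ 2)); [rewrite H; ring|ring].
Qed.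

Lemma closure_slice_conj (U : quat -> Prop) (j : quat)
    (hU : axially_symmetric U) (hj : imag_unit j) (z : C) :
  closure (slice j U) z -> closure (slice j U) (Cconj z).
Proof.
intros H; apply closure_Cmod; intros e He.
destruct (proj1 (closure_Cmod _ _) H e He) as (w & Hw & HU).
exists (Cconj w); rewrite Cmod_conj_minus; split; [assumption|].
now apply slice_conj.
Qed.

(* The point of the sphere [q] lying in C_j on the same side of the real axis as (x, y);
   the sign s tells that side. *)
Lemma norm_slice_repr (j : quat) (hj : imag_unit j) (q : quat) (x y : R) (s : R) :
  s = 1 \/ s = -1 -> 0 <= s * y ->
  Cmod ((qRe q, s * norm (qIm q)) - (x, y)) <= norm (minus q (slice_pt j (x, y))).
Proof.
intros Hs Hy.
destruct (imag_unit_coord _ hj) as (b & c & d & -> & H).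
destruct q as [[[q0 q1] q2] q3]; rewrite slice_pt_coord.
unfold minus; rewrite quat_opp, quat_plus.
simpl qRe; simpl qIm; rewrite !norm_quat.
set (r := sqrt (0 ^ 2 + q1 ^ 2 + q2 ^ 2 + q3 ^ 2)).
unfold Cmod, Cminus, Cplus, Copp; simpl fst; simpl snd.
assert (Hr0 : 0 <= r) by apply sqrt_pos.
assert (Hr : r * r = q1 ^ 2 + q2 ^ 2 + q3 ^ 2).
{ unfold r; rewrite sqrt_def; [ring|].
  assert (H1 := pow2_ge_0 q1); assert (H2 := pow2_ge_0 q2); assert (H3 := pow2_ge_0 q3).
  lra. }
apply sqrt_le_1_alt.
(* Cauchy-Schwarz for Im q and the unit vector j. *)
assert (Hcs : s * (q1 * b + q2 * c + q3 * d) <= r).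
{ apply Rsqr_incr_0_var; [unfold Rsqr; rewrite Hr|assumption].
  replace (s * (q1 * b + q2 * c + q3 * d) * (s * (q1 * b + q2 * c + q3 * d)))
    with ((q1 * b + q2 * c + q3 * d) ^ 2) by (destruct Hs; subst s; ring).
  rewrite <- (Rmult_1_r (_ + q3 ^ 2)), <- H.
  assert (H1 := pow2_ge_0 (q1 * c - q2 * b)); assert (H2 := pow2_ge_0 (q1 * d - q3 * b)).
  assert (H3 := pow2_ge_0 (q2 * d - q3 * c)); nra. }
assert (Hsy : s * y * (s * (q1 * b + q2 * c + q3 * d)) <= s * y * r)
  by now apply Rmult_le_compat_l.
replace (s * y * (s * (q1 * b + q2 * c + q3 * d))) with (y * (q1 * b + q2 * c + q3 * d))
  in Hsy by (destruct Hs; subst s; ring).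
replace ((s * r + - y) ^ 2) with (r * r - 2 * (s * y * r) + y ^ 2)
  by (destruct Hs; subst s; ring).
rewrite Hr.
replace (y ^ 2) with (y ^ 2 * (b ^ 2 + c ^ 2 + d ^ 2)) by (rewrite H; ring).
lra.
Qed.

(** A point q of U close to z need not lie in C_j. Axial symmetry allows replacing it by the point
    of [q] in C_j on the side of z, which by [norm_slice_repr] is at least as close to z. *)
Lemma closure_slice (U : quat -> Prop) (j : quat)
    (hU : axially_symmetric U) (hj : imag_unit j) (z : C) :
  closure U (slice_pt j z) -> closure (slice j U) z.
Proof.
intros H; apply closure_Cmod; intros e He.
destruct (proj1 (closure_norm _ _ _) H e He) as (q & Hq & HU).
destruct (slice_repr U j hU hj q HU) as [H1 H2].
destruct z as [x y].
destruct (Rle_dec 0 y) as [Hy|Hy].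
- exists (qRe q, 1 * norm (qIm q)); split.
  + eapply Rle_lt_trans; [apply (norm_slice_repr j hj q x y 1); [now left|lra]|exact Hq].
  + now rewrite Rmult_1_l.
- exists (qRe q, -1 * norm (qIm q)); split.
  + eapply Rle_lt_trans; [apply (norm_slice_repr j hj q x y (-1)); [now right|lra]|exact Hq].
  + now replace (-1 * norm (qIm q)) with (- norm (qIm q)) by ring.
Qed.

Lemma slice_closure (j : quat) (hj : imag_unit j) (A : quat -> Prop) (z : C) :
  closure (slice j A) z -> closure A (slice_pt j z).
Proof.
intros H; apply (closure_norm _ A); intros e He.
destruct (proj1 (closure_Cmod _ _) H e He) as (w & Hw & HA).
exists (slice_pt j w); split; [now rewrite norm_slice_minus|assumption].
Qed.

(** As U is open, its boundary points lie outside U, so the closure of the complement causes no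
    difficulty; axial symmetry enters only through the closure of U. *)
Lemma boundary_slice (U : quat -> Prop) (j : quat)
    (hU : axially_symmetric U) (hj : imag_unit j) (z : C) : open U ->
  (slice j (boundary U) z <-> boundary (slice j U) z).
Proof.
intros Ho; split.
- intros H; split; [apply (closure_slice U j hU hj z), H|].
  apply (closure_subset (T := C_UniformSpace)); exact (open_boundary U _ Ho H).
- intros [H1 H2]; split; [now apply slice_closure|].
  now apply (slice_closure j hj (fun q => ~ U q)).
Qed.

(** * Continuity on the slice and limits along arcs and normals *)

Definition cont_on (X : CompleteNormedModule R_AbsRing) (S : C -> Prop) (G : C -> X)
    : Prop :=
  forall z, S z -> forall e, 0 < e -> exists d, 0 < d /\
    forall w, S w -> Cmod (w - z) < d -> norm (minus (G w) (G z)) < e.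

Lemma norm_minus_diag (V : NormedModule R_AbsRing) (x : V) :
  norm (minus x x) = 0.
Proof. rewrite minus_eq_zero; apply (norm_zero (V := V)). Qed.

Lemma holder_on_cont (V W : NormedModule R_AbsRing) (alpha : R) (D : V -> Prop)
    (g : V -> W) : 0 < alpha -> holder_on alpha D g ->
  forall x, D x -> forall e, 0 < e -> exists d, 0 < d /\
    forall y, D y -> norm (minus y x) < d -> norm (minus (g y) (g x)) < e.
Proof.
intros Ha [M HM] x Hx e He.
set (K := Rabs M + 1).
assert (HK : 0 < K) by (unfold K; assert (H := Rabs_pos M); lra).
assert (HeK : 0 < e / K) by now apply Rdiv_lt_0_compat.
exists (Rpower (e / K) (/ alpha)); split; [apply exp_pos|].
intros y Hy Hxy.
(* Coinciding points are treated apart: [Rpower 0 alpha] is 1 by convention, and [holder_on]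
   excludes them. *)
destruct (Req_dec (norm (minus y x)) 0) as [E|E].
- apply norm_eq_zero in E.
  assert (E' : y = x).
  { transitivity (plus (minus y x) x); [|rewrite E; apply plus_zero_l].
    unfold minus; now rewrite <- plus_assoc, plus_opp_l, plus_zero_r. }
  now rewrite E', norm_minus_diag.
- assert (Hp : 0 < norm (minus y x)).
  { destruct (norm_ge_0 (minus y x)) as [h|h]; [exact h|now rewrite <- h in E]. }
  assert (Hlt : Rpower (norm (minus y x)) alpha < e / K).
  { replace (e / K) with (Rpower (Rpower (e / K) (/ alpha)) alpha).
    - apply Rlt_Rpower_l; [assumption|split; assumption].
    - rewrite Rpower_mult, Rinv_l, Rpower_1; lra. }
  eapply Rle_lt_trans.
  { apply HM; auto; intros ->; apply E, norm_minus_diag. }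
  apply Rle_lt_trans with (K * Rpower (norm (minus y x)) alpha).
  + apply Rmult_le_compat_r; [apply Rlt_le, exp_pos|].
    unfold K; assert (H := Rle_abs M); lra.
  + apply Rlt_div_r in Hlt; lra.
Qed.

Lemma holder_on_slice_cont (X : qbanach) (j : quat) (hj : imag_unit j) (alpha : R)
    (D : quat -> Prop) (g : quat -> X) : 0 < alpha -> holder_on alpha D g ->
  cont_on X (slice j D) (fun z => g (slice_pt j z)).
Proof.
intros Ha Hg z Hz e He.
destruct (holder_on_cont _ _ alpha D g Ha Hg (slice_pt j z) Hz e He) as (d & Hd & H).
exists d; split; [assumption|].
intros w Hw Hwz; apply (H (slice_pt j w) Hw).
now rewrite <- (norm_slice_minus j) in Hwz.
Qed.

Lemma slice_holder_cont (X : qbanach) (j : quat) (hj : imag_unit j) (alpha : R)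
    (A : quat -> Prop) (f : quat -> X) : 0 < alpha -> slice_holder X alpha j A f ->
  cont_on X (slice j A) (fun z => f (slice_pt j z)).
Proof.
intros Ha (f0 & f1 & Hf & H0 & H1) z Hz e He.
destruct (holder_on_cont _ _ alpha _ f0 Ha H0 z Hz (e / 2) ltac:(lra)) as (d0 & Hd0 & C0).
destruct (holder_on_cont _ _ alpha _ f1 Ha H1 z Hz (e / 2) ltac:(lra)) as (d1 & Hd1 & C1).
exists (Rmin d0 d1); split; [now apply Rmin_pos|].
intros w Hw Hwz.
specialize (C0 w Hw); specialize (C1 w Hw).
change (minus w z) with (w - z)%C in C0, C1.
rewrite <- Cmod_norm in C0, C1.
specialize (C0 (Rlt_le_trans _ _ _ Hwz (Rmin_l _ _))).
specialize (C1 (Rlt_le_trans _ _ _ Hwz (Rmin_r _ _))).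
assert (E : forall s, slice j A s -> f (slice_pt j s) = plus (f0 s) (lact j (f1 s))).
{ intros [u v] Hs; apply (Hf u v Hs). }
rewrite (E w Hw), (E z Hz), (minus_plus_plus (CompleteNormedModule.AbelianGroup _ X)).
eapply Rle_lt_trans; [apply (norm_triangle (V := X))|].
assert (Hn : norm (minus (lact j (f1 w)) (lact j (f1 z))) = norm (minus (f1 w) (f1 z))).
{ rewrite <- (linear_minus _ _ _ (lact_linear X j)), norm_lact.
  rewrite (proj2 hj); apply Rmult_1_l. }
apply Rlt_le_trans with (e / 2 + e / 2); [|lra].
apply Rplus_lt_compat; [exact C0|].
exact (Rle_lt_trans _ _ _ (Req_le _ _ Hn) C1).
Qed.

Lemma cont_on_path (X : CompleteNormedModule R_AbsRing) (S : C -> Prop) (G : C -> X)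
    (a b : R) (p : R -> C) :
  cont_on X S G -> cont_within (T := C_UniformSpace) a b p ->
  (forall t, a <= t <= b -> S (p t)) ->
  cont_within a b (fun t => G (p t)).
Proof.
intros HG Hp HS t Ht; apply filterlim_locally; intros e.
destruct (HG (p t) (HS t Ht) e (cond_pos e)) as (d & Hd & H).
destruct (Hp t Ht _ (locally_Cmod_lt _ d Hd)) as [r Hr].
exists r; intros s Hs Hab; apply (norm_compat1 (V := X)), H; auto.
Qed.

Lemma open_interval_dense (a b t d : R) :
  a < b -> a <= t <= b -> 0 < d -> exists s, a < s < b /\ Rabs (s - t) < d.
Proof.
intros Hab Ht Hd.
(* The point sought is t moved towards the midpoint by the proportion r. A positive r makes it
   interior, and the midpoint is at most (b - a)/2 away, so the displacement is at most d/2. *)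
set (r := Rmin (1 / 2) (d / (b - a))).
assert (Hr : 0 < r <= 1 / 2).
{ split; [|apply Rmin_l].
  apply Rmin_pos; [lra|]; apply Rdiv_lt_0_compat; lra. }
assert (Hrd : r * (b - a) <= d).
{ apply Rle_div_r; [lra|apply Rmin_r]. }
exists (t + r * ((a + b) / 2 - t)); split; [nra|].
apply Rabs_def1; nra.
Qed.

(** Both limits at t are taken through the open interval, whose traces near t form a proper filter
    even when t is an end point; uniqueness of limits then applies. This carries the jump relation
    to the corners. *)
Lemma cont_within_eq (V : NormedModule R_AbsRing) (a b : R) (g h : R -> V) :
  a < b -> cont_within a b g -> cont_within a b h ->
  (forall t, a < t < b -> g t = h t) ->
  forall t, a <= t <= b -> g t = h t.
Proof.
intros Hab Hg Hh E t Ht.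
set (F := within (fun s => a < s < b) (locally t)).
assert (HF : ProperFilter F).
{ split; [|apply within_filter, locally_filter].
  intros P [d Hd].
  destruct (open_interval_dense a b t d Hab Ht (cond_pos d)) as (s & Hs & Hst).
  exists s; now apply Hd. }
apply (filterlim_locally_unique (F := F) g).
- intros P HP; destruct (Hg t Ht P HP) as [d Hd].
  exists d; intros s Hs Hs'; apply Hd; [assumption|lra].
- apply filterlim_ext_loc with h.
  + exists (mkposreal 1 Rlt_0_1); intros s _ Hs; symmetry; now apply E.
  + intros P HP; destruct (Hh t Ht P HP) as [d Hd].
    exists d; intros s Hs Hs'; apply Hd; [assumption|lra].
Qed.

Lemma cont_on_limit (X : CompleteNormedModule R_AbsRing) (S : C -> Prop) (G : C -> X)
    (z v : C) (d0 : R) :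
  cont_on X S G -> S z -> 0 < d0 ->
  (forall eps, 0 < eps < d0 -> S (z + RtoC eps * v)%C) ->
  filterlim (fun eps => G (z + RtoC eps * v)%C) (at_right 0) (locally (G z)).
Proof.
intros HG Hz Hd0 HS; apply (filterlim_at_right_0 X); intros e He.
destruct (HG z Hz e He) as (d & Hd & H).
assert (Hv := Cmod_ge_0 v).
exists (Rmin d0 (d / (1 + Cmod v))); split.
{ apply Rmin_pos; [assumption|apply Rdiv_lt_0_compat; lra]. }
intros eps [He0 He1]; apply H.
- apply HS; split; [assumption|]; apply Rlt_le_trans with (1 := He1), Rmin_l.
- replace (z + RtoC eps * v - z)%C with (RtoC eps * v)%C by ring.
  rewrite Cmod_mult, Cmod_R, Rabs_pos_eq by lra.
  assert (He2 := Rlt_le_trans _ _ _ He1 (Rmin_r _ _)).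
  apply Rlt_div_r in He2; lra.
Qed.

(** * The jump formula and the equivalence *)

Lemma cauchy_jump (X : qbanach) (U : quat -> Prop) (hU_open : open U)
    (hU : axially_symmetric U) (j : quat) (hj : imag_unit j) (cs : list pcurve)
    (hcs : oriented_boundary (slice j U) cs)
    (f : quat -> X) (hf : cont_on X (slice j (boundary U)) (fun z => f (slice_pt j z)))
    (c : pcurve) (k : nat) (t : R) :
  In c cs -> (k <= nsub c)%nat -> knot c k < t < knot c (S k) ->
  filterlim (fun eps => minus
      (cauchy_transform X j cs f (slice_pt j (path c t + RtoC eps * (Ci * vel c k t))%C))
      (cauchy_transform X j cs f (slice_pt j (path c t - RtoC eps * (Ci * vel c k t))%C)))
    (at_right 0) (locally (f (slice_pt j (path c t)) : X)).
Proof.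
intros Hin Hk Ht.
destruct hcs as (Hcs & Hdisj & Hbd).
destruct (Hcs c Hin) as (_ & _ & Hor).
destruct (Hor k t Hk Ht) as (d0 & Hd0 & Hside).
set (z0 := path c t) in *; set (v0 := vel c k t) in *.
assert (Hbdon : forall c', In c' cs -> forall s, on_curve c' s -> boundary (slice j U) s).
{ intros c' Hc' s Hs; apply Hbd; eauto. }
assert (Hopen : forall s, boundary (slice j U) s -> ~ slice j U s).
{ intros s Hs; apply (open_boundary U); [assumption|].
  now apply (boundary_slice U j hU hj s hU_open). }
(* A contour point is in the closure of the slice of U but not in that slice. The orientation puts
   w+ in the slice and w- off its closure, and both sets are stable under conjugation, which
   excludes the four points at once. *)
assert (Hoff : forall eps s w, 0 < eps < d0 -> boundary (slice j U) s ->
  w = (z0 + RtoC eps * (Ci * v0))%C \/ w = (z0 - RtoC eps * (Ci * v0))%C ->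
  s <> w /\ s <> Cconj w).
{ intros eps s w Heps Hs Hw; destruct (Hside eps Heps) as [Hp Hm].
  destruct Hw as [-> | ->]; split; intros ->.
  - exact (Hopen _ Hs Hp).
  - exact (Hopen _ Hs (slice_conj U j hU hj _ Hp)).
  - exact (Hm (proj1 Hs)).
  - apply Hm; rewrite <- (Cconj_conj (z0 - _)%C).
    apply (closure_slice_conj U j hU hj), Hs. }
assert (Hcont : forall c', In c' cs -> cont_along X (fun s => f (slice_pt j s)) c').
{ intros c' Hc' l Hl; destruct (Hcs c' Hc') as (Hpw & _ & _).
  apply cont_on_path with (1 := hf).
  - apply derive_within_cont with (vel c' l), (closed_pw_C1_arc c' l Hpw Hl).
  - intros s Hs; apply (boundary_slice U j hU hj _ hU_open), (Hbdon c' Hc').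
    apply on_curve_arc with l; auto; now apply closed_pw_C1_knot. }
assert (Hlim := curves_jump X j hj f cs c k t d0 Hdisj Hin Hk Ht).
fold z0 v0 in Hlim.
apply (filterlim_comp _ _ _ _ (scal (/ (2 * PI))) _ _
  (locally (scal (/ (2 * PI)) (scal (2 * PI) (f (slice_pt j z0)) : X)))) in Hlim.
- rewrite (scal_assoc (V := X)) in Hlim.
  change (mult (/ (2 * PI)) (2 * PI)) with (/ (2 * PI) * (2 * PI)) in Hlim.
  rewrite Rinv_l, (scal_one (V := X)) in Hlim by (assert (H := PI_RGT_0); lra).
  apply filterlim_ext_loc with (2 := Hlim).
  exists (mkposreal d0 Hd0); intros eps Heps Hpos.
  change (Rabs (eps - 0) < d0) in Heps.
  rewrite Rminus_0_r, Rabs_pos_eq in Heps by lra.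
  unfold cauchy_transform; rewrite <- (scal_minus_distr_l (V := X)); f_equal.
  rewrite (fold_plus_minus (CompleteNormedModule.AbelianGroup _ X)).
  apply (fold_plus_ext (CompleteNormedModule.AbelianGroup _ X)); intros c' Hc'.
  symmetry; apply curve_integral_jump; auto.
  + apply (Hcs c' Hc').
  + intros s w Hs; apply Hoff; auto; apply (Hbdon c' Hc' s Hs).
- intros c' Hc'; destruct (Hcs c' Hc') as (H1 & H2 & _).
  split; [|split; [|split]]; auto.
  intros eps s Heps Hs; assert (Hb := Hbdon c' Hc' s Hs).
  split; apply (Hoff eps s); auto.
- assumption.
- apply (filterlim_scal_r (V := X)).
Qed.

Theorem theorem4p8 (X : qbanach) (U : quat -> Prop)
    (hU_open : open U) (hU_bounded : qbounded U)
    (hU_axial : axially_symmetric U)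
    (Gamma : quat -> list pcurve)
    (hGamma : forall i : quat, imag_unit i ->
       oriented_boundary (slice i U) (Gamma i))
    (j : quat) (hj : imag_unit j)
    (alpha : R) (halpha : 0 < alpha < 1)
    (f : quat -> X) (hf : slice_holder X alpha j (boundary U) f) :
  let fhat := cauchy_transform X j (Gamma j) f in
  ((exists fp : quat -> X, holder_ext_plus X alpha U fhat fp) /\
   (exists fm : option quat -> X, holder_ext_minus X alpha U fhat fm))
  <->
  (exists (fp : quat -> X) (fm : option quat -> X),
     holder_ext_plus X alpha U fhat fp /\
     holder_ext_minus X alpha U fhat fm /\
     forall z : C, slice j (boundary U) z ->
       f (slice_pt j z) =
       plus (fp (slice_pt j z)) (fm (Some (slice_pt j z)))).
Proof.
intros fhat; split.
2: { intros (fp & fm & Hp & Hm & _); split; eauto. }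
intros [[fp [Hp1 Hp2]] [fm [Hm1 Hm2]]]; exists fp, fm.
repeat split; [assumption|assumption|assumption|apply Hm2|apply Hm2|].
intros z Hz.
assert (hcs := hGamma j hj).
assert (hfc := slice_holder_cont X j hj alpha (boundary U) f (proj1 halpha) hf).
assert (hpc := holder_on_slice_cont X j hj alpha (closure U) fp (proj1 halpha) Hp2).
assert (hmc := holder_on_slice_cont X j hj alpha (closure (exterior U))
  (fun p => fm (Some p)) (proj1 halpha) (proj1 Hm2)).
assert (Hjump := cauchy_jump X U hU_open hU_axial j hj (Gamma j) hcs f hfc).
destruct hcs as (Hcs & _ & Hbd).
assert (Hz' := proj1 (boundary_slice U j hU_axial hj z hU_open) Hz).
apply Hbd in Hz'; destruct Hz' as (c & Hc & s & Hs & <-).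
destruct (Hcs c Hc) as (Hpw & _ & Hor).
destruct (knot_cover c s (nsub c) Hs) as (k & Hk & Hsk).
assert (Hb : forall t, knot c k <= t <= knot c (S k) -> slice j (boundary U) (path c t)).
{ intros t Ht; apply (boundary_slice U j hU_axial hj _ hU_open), Hbd.
  exists c; split; [assumption|].
  apply on_curve_arc with k; auto; now apply closed_pw_C1_knot. }
assert (Harc := closed_pw_C1_arc c k Hpw Hk).
assert (Hpath := derive_within_cont _ _ _ _ (proj1 (proj2 Harc))).
(* The function f_- is controlled only on the closure of the exterior, and a boundary point of an
   open set need not belong to it. At a smooth point, the points w- given by the orientation
   approach it from the exterior. *)
assert (Hext : forall t, knot c k < t < knot c (S k) ->
  closure (slice j (exterior U)) (path c t)).
{ intros t Ht; apply closure_Cmod; intros e He.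
  destruct (Hor k t Hk Ht) as (d & Hd & Hside).
  set (v := (Ci * vel c k t)%C) in *.
  assert (Hv := Cmod_ge_0 v).
  assert (Hev : 0 < e / (1 + Cmod v)) by (apply Rdiv_lt_0_compat; lra).
  assert (Hm : 0 < Rmin d (e / (1 + Cmod v))) by now apply Rmin_pos.
  set (eps := Rmin d (e / (1 + Cmod v)) / 2).
  assert (H1 := Rmin_l d (e / (1 + Cmod v))); assert (H2 := Rmin_r d (e / (1 + Cmod v))).
  assert (Heps : 0 < eps /\ eps < d /\ eps < e / (1 + Cmod v)) by (unfold eps; lra).
  destruct Heps as (He0 & He1 & He2).
  exists (path c t - RtoC eps * v)%C; split.
  - replace (path c t - RtoC eps * v - path c t)%C with (- (RtoC eps * v))%C by ring.
    rewrite Cmod_opp, Cmod_mult, Cmod_R, Rabs_pos_eq by lra.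
    apply Rlt_div_r in He2; lra.
  - intros H; apply (proj2 (Hside eps (conj He0 He1))).
    now apply (closure_slice U j hU_axial hj). }
(* The ends of the arc are limits of its smooth points: half of e is spent along the arc, the other
   half towards the exterior. *)
assert (Hext' : forall t, knot c k <= t <= knot c (S k) ->
  slice j (closure (exterior U)) (path c t)).
{ intros t Ht; apply (slice_closure j hj (exterior U)), closure_Cmod; intros e He.
  destruct (Hpath t Ht _ (locally_Cmod_lt _ (e / 2) ltac:(lra))) as [d Hd].
  destruct (open_interval_dense _ _ t d (proj1 Harc) Ht (cond_pos d)) as (t' & Ht' & Htt').
  assert (Hn := Hd t' Htt' ltac:(lra)).
  destruct (proj1 (closure_Cmod _ _) (Hext t' Ht') (e / 2) ltac:(lra)) as (w & Hw & HwU).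
  exists w; split; [|assumption].
  replace (w - path c t)%C with ((w - path c t') + (path c t' - path c t))%C by ring.
  eapply Rle_lt_trans; [apply Cmod_triangle|lra]. }
apply (cont_within_eq X (knot c k) (knot c (S k)) (fun t => f (slice_pt j (path c t)))
  (fun t => plus (fp (slice_pt j (path c t))) (fm (Some (slice_pt j (path c t)))))).
- apply Harc.
- apply (cont_on_path X _ _ _ _ (path c) hfc Hpath Hb).
- intros t Ht; apply (filterlim_plus_eq X) with (4 := eq_refl).
  + typeclasses eauto.
  + apply (cont_on_path X _ _ _ _ (path c) hpc Hpath); [|assumption].
    intros u Hu; apply (Hb u Hu).
  + apply (cont_on_path X _ _ _ _ (path c) hmc Hpath); assumption.
- intros t Ht.
  destruct (Hor k t Hk Ht) as (d & Hd & Hside).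
  specialize (Hjump c k t Hc Hk Ht).
  assert (Hp := cont_on_limit X _ _ (path c t) (Ci * vel c k t)%C d hpc
    (proj1 (Hb t ltac:(lra))) Hd
    (fun eps Heps => closure_subset U _ (proj1 (Hside eps Heps)))).
  assert (Hout : forall eps, 0 < eps < d ->
    exterior U (slice_pt j (path c t - RtoC eps * (Ci * vel c k t))%C)).
  { intros eps Heps H; apply (proj2 (Hside eps Heps)).
    now apply (closure_slice U j hU_axial hj). }
  assert (Hm : filterlim
    (fun eps => fm (Some (slice_pt j (path c t - RtoC eps * (Ci * vel c k t))%C)))
    (at_right 0) (locally (fm (Some (slice_pt j (path c t)))))).
  { eapply filterlim_ext.
    2: { apply (cont_on_limit X _ _ (path c t) (- (Ci * vel c k t))%C d hmc
           (Hext' t ltac:(lra)) Hd).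
         intros eps Heps; apply closure_subset.
         replace (path c t + RtoC eps * - (Ci * vel c k t))%C
           with (path c t - RtoC eps * (Ci * vel c k t))%C by ring.
         now apply Hout. }
    intros eps; simpl; do 3 f_equal; ring. }
  (* The sign in f_- = - fhat turns the difference fhat(w+) - fhat(w-) into f_+(w+) + f_-(w-) for
     small eps, so one and the same function of eps has both limits. *)
  apply (filterlim_locally_unique (V := X) _ _ _ Hjump).
  eapply filterlim_ext_loc.
  2: { apply (filterlim_plus_eq X) with (2 := Hp) (3 := Hm) (4 := eq_refl).
       typeclasses eauto. }
  exists (mkposreal d Hd); intros eps Heps Hpos.
  change (Rabs (eps - 0) < d) in Heps.
  rewrite Rminus_0_r, Rabs_pos_eq in Heps by lra.
  destruct (Hside eps (conj Hpos Heps)) as [Hin _].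
  now rewrite (Hp1 _ Hin), (Hm1 _ (Hout eps (conj Hpos Heps))).
- assumption.
Qed.
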